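(* Let $\varepsilon=\mathcal{O}(h^\beta)$ for some $\beta\ge2$, let $0<h<h_0$, and let $f\in L^2(\Omega)$. Then there is a unique $u_h^\varepsilon\in V_h$ satisfying $$\varepsilon(\Delta u_h^\varepsilon,\Delta v_h)-(A:D^2u_h^\varepsilon,v_h)=(f,v_h)\qquad\forall v_h\in V_h,$$ and $$\|u_h^\varepsilon\|_{H^2(\Omega)}\le C\|f\|_{L^2(\Omega)},$$ with a constant $C>0$ independent of $h$, $\varepsilon$ and $f$.
   Context: $\Omega\subset\mathbb{R}^n$ is an open bounded domain; $A\in[C(\overline\Omega)]^{n\times n}$ is uniformly elliptic: $\lambda|\xi|^2\le A(x)\xi\cdot\xi\le\overline\lambda|\xi|^2$ for all $\xi\in\mathbb{R}^n$, $x\in\overline\Omega$, with $0<\lambda\le\overline\lambda$. $(\cdot,\cdot)$ is the $L^2(\Omega)$ inner product; $A:D^2v=\sum_{i,j}A_{ij}v_{x_ix_j}$. $\varepsilon=\varepsilon(h)>0$, and $\varepsilon=\mathcal{O}(h^\beta)$ means $\varepsilon\le C_0h^\beta$ with $C_0$ independent of $h$. For each mesh size $h>0$, $\mathcal{T}_h$ is a quasi-uniform, shape-regular mesh of $\Omega$, and $V_h=\{v_h\in C^1(\overline\Omega)\cap H_0^1(\Omega): v_h|_T\in\mathbb{P}_k(T)\ \forall T\in\mathcal{T}_h\}\subset H^2(\Omega)\cap H^1_0(\Omega)$ is a $C^1$ conforming finite element space ($\mathbb{P}_k(T)$: polynomials of total degree $\le k$; e.g. cubic Hermite elements in 1-D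 with $k\ge3$, Argyris elements in 2-D with $k\ge5$). Standing assumption: the problem $\mathcal{L}^\varepsilon u^\varepsilon:=\varepsilon\Delta^2u^\varepsilon-A:D^2u^\varepsilon=f$ in $\Omega$, $u^\varepsilon=\Delta u^\varepsilon=0$ on $\partial\Omega$, has a unique weak solution $u^\varepsilon\in H^2(\Omega)\cap H_0^1(\Omega)$ (that is, $\varepsilon(\Delta u^\varepsilon,\Delta v)-(A:D^2u^\varepsilon,v)=(f,v)$ for all $v\in H^2(\Omega)\cap H_0^1(\Omega)$), for each $f\in L^2(\Omega)$, and $\|v\|_{H^2(\Omega)}\le C\|\mathcal{L}^\varepsilon v\|_{L^2(\Omega)}$ with $C$ independent of $\varepsilon$ and $v$, for $v\in H^2(\Omega)\cap H_0^1(\Omega)$ whose image $\mathcal{L}^\varepsilon v$ (in the weak sense) is in $L^2(\Omega)$. Let $(\mathcal{L}_h^\varepsilon)^*:V_h\to V_h$ be defined by $((\mathcal{L}_h^\varepsilon)^*w_h,v_h)=\varepsilon(\Delta v_h,\Delta w_h)-(A:D^2v_h,w_h)$ for all $v_h\in V_h$, and $\|v\|_{H_h^{-2}(\Omega)}=\sup_{0\ne w_h\in V_h}(v,w_h)/\|w_h\|_{H^2(\Omega)}$. The constant $h_0>0$ is a fixed threshold (whose existence the paper establishes) such that for all $h<h_0$ and $\varepsilon=\mathcal{O}(h^\beta)$ with $\beta\ge2$, $\|v_h\|_{L^2(\Omega)}\le C\|(\mathcal{L}_h^\varepsilon)^*v_h\|_{H_h^{-2}(\Omega)}$ for all $v_h\in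 V_h$, with $C$ independent of $h$, $\varepsilon$, $v_h$. *)

(* Defs.v *)
From HB Require Import structures.
From mathcomp Require Import all_boot all_order all_algebra.
From mathcomp Require Import all_classical all_reals all_analysis.

Set Implicit Arguments.
Unset Strict Implicit.
Unset Printing Implicit Defensive.

Import Order.TTheory GRing.Theory Num.Theory.
Import numFieldNormedType.Exports.

Local Open Scope classical_set_scope.
Local Open Scope ring_scope.

Definition rV_display : measure_display. Proof. exact. Qed.

(* The sigma-algebra generated by the coordinates, which is the Borel one. *)
Section rV_measurable.
Context {R : realType} (n : nat).

Let coor (i : 'I_n) (x : 'rV[R]_n) : R := x 0 i.

Let rV_set0 : g_sigma_preimage coor set0.
Proof. exact: sigma_algebra0. Qed.

Let rV_setC A : g_sigma_preimage coor A -> g_sigma_preimage coor (~` A).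
Proof. exact: sigma_algebraC. Qed.

Let rV_bigcup (F : (set 'rV[R]_n)^nat) :
  (forall i, g_sigma_preimage coor (F i)) ->
  g_sigma_preimage coor (\bigcup_i F i).
Proof. exact: sigma_algebra_bigcup. Qed.

HB.instance Definition _ := @isMeasurable.Build rV_display
  'rV[R]_n (g_sigma_preimage coor) rV_set0 rV_setC rV_bigcup.

Lemma measurable_coor (i : 'I_n) :
  measurable_fun [set: 'rV[R]_n] (fun x : 'rV[R]_n => x 0 i).
Proof.
move=> _ Y mY; rewrite setTI; apply: sub_sigma_algebra => /=.
rewrite -bigcup_seq/=; exists i => /=; first by rewrite mem_index_enum.
by exists Y => //; rewrite setTI.
Qed.

Lemma measurable_to_rV d (T : measurableType d) (f : T -> 'rV[R]_n) :
  (forall i, measurable_fun setT (fun t => f t 0 i)) -> measurable_fun setT f.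
Proof.
move=> mf _ A mA; rewrite setTI; move: A mA.
suff : g_sigma_preimage coor `<=` [set A | measurable (f @^-1` A)] by [].
apply: smallest_sub.
  split=> /=.
  - by rewrite preimage_set0.
  - by move=> A mA; rewrite setTD preimage_setC; exact: measurableC.
  - by move=> F mF; rewrite preimage_bigcup; exact: bigcup_measurable.
rewrite -bigcup_seq; apply: bigcup_sub => i _ _ [B mB <-] /=.
by rewrite setTI; have := mf i measurableT B mB; rewrite setTI.
Qed.

End rV_measurable.

Section lebesgue_step.
Context {R : realType} (n : nat).
Variable m : {sigma_finite_measure set 'rV[R]_n -> \bar R}.

Definition rV_cons (p : R * 'rV[R]_n) : 'rV[R]_n.+1 :=
  row_mx (p.1)%:M p.2 : 'rV_(1 + n).
Definition rV_uncons (x : 'rV[R]_n.+1) : R * 'rV[R]_n :=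
  (x 0 0, \row_i x 0 (lift ord0 i)).

Lemma rV_cons0 p : rV_cons p 0 0 = p.1.
Proof.
rewrite [LHS](_ : _ = row_mx (p.1)%:M p.2 0 (lshift n 0)).
  by rewrite row_mxEl mxE eqxx.
by congr (row_mx _ _ _ _); exact/val_inj.
Qed.

Lemma rV_consS p i : rV_cons p 0 (lift ord0 i) = p.2 0 i.
Proof.
have -> : lift ord0 i = rshift 1 i :> 'I_(1 + n) by exact: val_inj.
exact: row_mxEr.
Qed.

Lemma rV_consK : cancel rV_cons rV_uncons.
Proof.
case=> t x; rewrite /rV_uncons rV_cons0; congr pair.
by apply/rowP => i; rewrite mxE rV_consS.
Qed.

Lemma measurable_rV_cons : measurable_fun setT rV_cons.
Proof.
apply: measurable_to_rV => i; case: (unliftP ord0 i) => [j ->|->].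
  under eq_fun do rewrite rV_consS.
  exact: (measurableT_comp (measurable_coor j) measurable_snd).
under eq_fun do rewrite rV_cons0.
exact: measurable_fst.
Qed.

Lemma measurable_rV_uncons : measurable_fun setT rV_uncons.
Proof.
apply: measurable_fun_pair; first exact: measurable_coor.
apply: measurable_to_rV => i; under eq_fun do rewrite mxE.
exact: measurable_coor.
Qed.

Definition lebesgue_step : set 'rV[R]_n.+1 -> \bar R :=
  pushforward (@lebesgue_measure R \x m)%E rV_cons.

Let lebesgue_step0 : (lebesgue_step set0 = 0)%E.
Proof. by rewrite /lebesgue_step /pushforward preimage_set0 measure0. Qed.

Let lebesgue_step_ge0 A : (0 <= lebesgue_step A)%E.
Proof. rewrite /lebesgue_step /pushforward; exact: measure_ge0. Qed.

Let mcons A : measurable A -> measurable (rV_cons @^-1` A).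
Proof. by move=> mA; have := measurable_rV_cons measurableT mA; rewrite setTI. Qed.

Let lebesgue_step_additive : semi_sigma_additive lebesgue_step.
Proof.
move=> F mF tF mUF; rewrite /lebesgue_step /pushforward preimage_bigcup.
apply: measure_semi_sigma_additive.
- by move=> k; exact: mcons.
- apply/trivIsetP => i j _ _ ij; rewrite -preimage_setI.
  by move/trivIsetP : tF => /(_ _ _ _ _ ij) ->//; rewrite preimage_set0.
- by rewrite -preimage_bigcup; exact: mcons.
Qed.

HB.instance Definition _ := isMeasure.Build _ _ _ lebesgue_step
  lebesgue_step0 lebesgue_step_ge0 lebesgue_step_additive.

Let lebesgue_step_sigma_finite : sigma_finite setT lebesgue_step.
Proof.
have /sigma_finiteP[F [TF ndF Foo]] := sigma_finiteT (@lebesgue_measure R).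
have /sigma_finiteP[G [TG ndG Goo]] := sigma_finiteT m.
exists (fun k => rV_uncons @^-1` (F k `*` G k)).
  rewrite -preimage_bigcup (_ : \bigcup_k _ = setT) ?preimage_setT//.
  rewrite -subTset => -[x y] _.
  have [k _ Fkx] : (\bigcup_k F k) x by rewrite -TF.
  have [l _ Gly] : (\bigcup_k G k) y by rewrite -TG.
  exists (maxn k l) => //; split => /=.
    by move: x Fkx; exact/subsetPset/ndF/leq_maxl.
  by move: y Gly; exact/subsetPset/ndG/leq_maxr.
move=> k; have [mF Fk] := Foo k; have [mG Gk] := Goo k; split.
  have := measurable_rV_uncons measurableT (measurableX mF mG).
  by rewrite setTI.
rewrite /lebesgue_step /pushforward -comp_preimage.
rewrite (_ : rV_uncons \o rV_cons = id); last first.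
  by apply/funext => p; exact: rV_consK.
by rewrite preimage_id product_measure1E// lte_mul_pinfty// ge0_fin_numE.
Qed.

HB.instance Definition _ := Measure_isSigmaFinite.Build _ _ _ lebesgue_step
  lebesgue_step_sigma_finite.

End lebesgue_step.

Fixpoint lebesgue_rV (R : realType) (n : nat) :
    {sigma_finite_measure set 'rV[R]_n -> \bar R} :=
  match n with
  | 0 => (\d_(0 : 'rV[R]_0))
  | n'.+1 => lebesgue_step (lebesgue_rV R n')
  end.

Section geometry.
Context {R : realType} {n : nat}.
Implicit Types (T F : set 'rV[R]_n) (Th : set (set 'rV[R]_n)).

(* The library norm on ['rV[R]_n] is the sup norm; lengths are Euclidean. *)
Definition enorm (x : 'rV[R]_n) : R := Num.sqrt (\sum_i x 0 i ^+ 2).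

Definition eball (x : 'rV[R]_n) (r : R) : set 'rV[R]_n :=
  [set y | enorm (y - x) <= r].

Definition diam T : R :=
  sup [set r | exists x y, [/\ T x, T y & r = enorm (x - y)]].

Definition domain (Om : set 'rV[R]_n) : Prop :=
  [/\ open Om, connected Om, Om !=set0 & bounded_set Om].

Definition polytope T : Prop :=
  exists (m : nat) (p : 'I_m -> 'rV[R]_n),
    T = [set x | exists w : 'I_m -> R,
      [/\ forall i, 0 <= w i, \sum_i w i = 1 & x = \sum_i w i *: p i]].

(* From right to left, [F] is convex; from left to right, it is extreme. *)
Definition face F T : Prop :=
  F `<=` T /\
  forall x y (t : R), T x -> T y -> 0 < t < 1 ->
    F (t *: x + (1 - t) *: y) <-> F x /\ F y.

(* Two cells meet in a common face, possibly empty: no hanging nodes, and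
   distinct cells have disjoint interiors since no cell is flat. *)
Definition mesh (Om : set 'rV[R]_n) Th : Prop :=
  [/\ finite_set Th,
      forall T, Th T -> polytope T /\ interior T !=set0,
      \bigcup_(T in Th) T = closure Om
    & forall T T', Th T -> Th T' -> face (T `&` T') T /\ face (T `&` T') T'].

Definition mesh_size Th : R := sup [set diam T | T in Th].

(* A family of meshes [Th h], indexed by the set [Hs] of its mesh sizes *)
Definition mesh_family (Om : set 'rV[R]_n) (Hs : set R)
    (Th : R -> set (set 'rV[R]_n)) : Prop :=
  forall h, Hs h -> [/\ 0 < h, mesh Om (Th h) & mesh_size (Th h) = h].

Definition shape_regular (Hs : set R) (Th : R -> set (set 'rV[R]_n)) : Prop :=
  exists2 gamma : R, 0 < gamma &
    forall h T, Hs h -> Th h T ->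
      exists x r, [/\ 0 < r, eball x r `<=` T & diam T <= gamma * r].

Definition quasi_uniform (Hs : set R) (Th : R -> set (set 'rV[R]_n)) : Prop :=
  exists2 c : R, 0 < c & forall h T, Hs h -> Th h T -> c * h <= diam T.

End geometry.

(* Functions on a domain [Om] are functions on R^n whose values outside the
   closure of [Om] are irrelevant. *)
Section sobolev.
Context {R : realType} {n : nat}.
Local Notation E := 'rV[R]_n.
Variable Om : set E.
Implicit Types (f g u v w phi : E -> R) (s : seq 'I_n).

Definition partial (i : 'I_n) f : E -> R := fun x => 'D_(delta_mx 0 i) f x.

(* [partials [:: i; j]] is d^2/dx_i dx_j. *)
Definition partials s f : E -> R := foldr partial f s.

Definition smooth phi : Prop :=
  forall s, continuous (partials s phi) /\
    forall i x, derivable (partials s phi) x (delta_mx 0 i).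

Definition test_function phi : Prop :=
  smooth phi /\
  exists K : set E, [/\ compact K, K `<=` Om & forall x, ~ K x -> phi x = 0].

Definition L2 f : Prop :=
  measurable_fun Om f /\
  (lebesgue_rV R n).-integrable Om (fun x => (f x ^+ 2)%:E).

Definition inner f g : R := \int[lebesgue_rV R n]_(x in Om) (f x * g x).

Definition normL2 f : R := Num.sqrt (inner f f).

Definition weak_derivative s v g : Prop :=
  forall phi, test_function phi ->
    inner v (partials s phi) = (- 1) ^+ size s * inner g phi.

(* The weak derivative of [v] in L^2(Om), a representative of which is chosen;
   it is a junk value if there is none. *)
Definition wD s v : E -> R :=
  xget (fun=> 0) [set g | L2 g /\ weak_derivative s v g].

Definition sobolevH (m : nat) v : Prop :=
  L2 v /\
  forall s, (size s <= m)%N -> exists g, L2 g /\ weak_derivative s v g.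

Definition normH1 v : R :=
  Num.sqrt (normL2 v ^+ 2 + \sum_i normL2 (wD [:: i] v) ^+ 2).

Definition normH2 v : R :=
  Num.sqrt (normL2 v ^+ 2 + \sum_i normL2 (wD [:: i] v) ^+ 2
            + \sum_i \sum_j normL2 (wD [:: i; j] v) ^+ 2).

Definition H10 v : Prop :=
  sobolevH 1 v /\
  forall e : R, 0 < e ->
    exists2 phi, test_function phi & normH1 (fun x => v x - phi x) < e.

Definition H2H10 : set (E -> R) := [set v | sobolevH 2 v /\ H10 v].

Definition C1_closure v : Prop :=
  {within closure Om, continuous v} /\
  forall i, exists g : E -> R,
    {within closure Om, continuous g} /\
    forall x, Om x -> derivable v x (delta_mx 0 i) /\ partial i v x = g x.

End sobolev.

Section problem.
Context {R : realType} {n : nat}.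
Local Notation E := 'rV[R]_n.
Variables (Om : set E) (A : E -> 'M[R]_n).
Implicit Types (f g u v w : E -> R).

Definition uniformly_elliptic : Prop :=
  exists lam Lam : R, [/\ 0 < lam, lam <= Lam &
    forall x (xi : 'rV[R]_n), closure Om x ->
      let q := \sum_i (\sum_j A x i j * xi 0 j) * xi 0 i in
      lam * enorm xi ^+ 2 <= q <= Lam * enorm xi ^+ 2].

Definition laplacian v : E -> R := fun x => \sum_i wD Om [:: i; i] v x.

Definition AD2 v : E -> R :=
  fun x => \sum_i \sum_j A x i j * wD Om [:: i; j] v x.

Definition Bform (eps : R) u v : R :=
  eps * inner Om (laplacian u) (laplacian v) - inner Om (AD2 u) v.

Definition weak_solution (eps : R) f u : Prop :=
  H2H10 Om u /\ forall v, H2H10 Om v -> Bform eps u v = inner Om f v.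

Definition well_posed : Prop :=
  (forall eps f, 0 < eps -> L2 Om f ->
    exists2 u, weak_solution eps f u &
      forall u', weak_solution eps f u' ->
        {ae lebesgue_rV R n, forall x, Om x -> u' x = u x}) /\
  (exists2 C : R, 0 < C &
    forall eps v g, 0 < eps -> L2 Om g -> weak_solution eps g v ->
      normH2 Om v <= C * normL2 Om g).

(* On [T], [v] is a polynomial of total degree at most [k]; [a] ranges over
   the multi-indices. *)
Definition poly_on (k : nat) (T : set E) v : Prop :=
  exists c : {ffun 'I_n -> 'I_k.+1} -> R, forall x, T x ->
    v x = \sum_(a : {ffun 'I_n -> 'I_k.+1} | (\sum_i a i <= k)%N)
            c a * \prod_i x 0 i ^+ a i.

Definition fe_space (k : nat) (Th : set (set E)) : set (E -> R) :=
  [set v | [/\ C1_closure Om v, H10 Om v &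
              forall T, Th T -> poly_on k T v]].

Variable Vh : set (E -> R).

Definition discrete_solution (eps : R) f u : Prop :=
  Vh u /\ forall v, Vh v -> Bform eps u v = inner Om f v.

(* The Riesz representative in [Vh] of [Bform eps ^~ w] for the L^2 inner
   product; its values off the closure of [Om] are arbitrary. *)
Definition Lh_adjoint (eps : R) w : E -> R :=
  xget (fun=> 0)
    [set g | Vh g /\ forall v, Vh v -> inner Om g v = Bform eps v w].

(* A supremum of a set bounded above by the L^2 norm of [v]; it is 0 when
   [Vh] is trivial. *)
Definition normHm2 v : R :=
  sup [set inner Om v w / normH2 Om w |
       w in [set w | Vh w /\ exists2 x, Om x & w x != 0]].

End problem.

(* Main.v *)
Require Import Defs.
From HB Require Import structures.
From mathcomp Require Import all_boot all_order all_algebra.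
From mathcomp Require Import all_classical all_reals all_analysis.
From mathcomp Require Import measurable_realfun ring lra.
Import Order.TTheory GRing.Theory Num.Theory.
Import numFieldNormedType.Exports.
Local Open Scope classical_set_scope.
Local Open Scope ring_scope.

(** The finite element space [V] is finite dimensional as a space of functions
on the closure of the domain, and the discrete problem is a square linear
system for the form [B = Bform Om A eps].  The assumed bound for the adjoint
says [|v|_L2 <= C |L* v|_H-2], where the dual norm of [L* v] is at most [K] as
soon as [B w v <= K |w|_H2] for all [w] in [V] ([normHm2_adjoint_le]).  With
[K = 0] it makes [v |-> B(., v)] injective, hence the matrix of [B] invertible:
both the discrete problem and its transpose are uniquely solvable
([bilinear_solve]).

The bound on the solution [u] is the statement that an operator and its adjoint
have inverses of the same norm.  Solve the transposed problem for the functional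
[w |-> (u, w)_H2]: this gives [v] in [V] with [B w v = (u, w)_H2] for all [w] in
[V].  Cauchy-Schwarz in H^2 and the adjoint bound yield [|v|_L2 <= C |u|_H2], so
[|u|_H2 ^ 2 = B u v = (f, v) <= |f|_L2 * C * |u|_H2]
([discrete_solution_stable]).

What remains is to see that these objects behave linearly.  A weak derivative
[wD Om s v] is a chosen representative, so [B] and the H^2 inner product are
bilinear only because weak derivatives are unique almost everywhere.  This is
the fundamental lemma of the calculus of variations
([test_orthogonal_ae_eq0]): products of the functions [exp (- 1 / (k t))] are
test functions increasing to the indicator of a box, so a function orthogonal to
all test functions has integral zero over every box whose closure lies in the
domain, and boxes determine the measurable sets.  That [V] is stable under
linear combinations requires the same of H^1_0; there the triangle inequality
for [v - phi] requires a test function [phi] to have its partial derivatives as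
weak derivatives, that is, integration by parts ([test_function_by_parts]), by
Fubini and the fundamental theorem of calculus in one coordinate
([integral_partial_eq0]).  Last, an element of [V] of zero L^2 norm vanishes on
the closure of the domain since it is continuous there and nonempty open sets
have positive measure ([fe_space_normL2_eq0]). *)

Set Implicit Arguments.
Unset Strict Implicit.
Unset Printing Implicit Defensive.

(** * Square linear systems on spaces of functions *)

Section finite_dimension.
Context {X : Type} {F : fieldType} (D : set X) (V : set (X -> F)).

Definition lincomb_closed :=
  V (fun=> 0) /\
  forall a u v, V u -> V v -> V (fun x => a * u x + v x).

(** Elements of [V] are compared on [D] only, because the values of a finite
    element function off the closure of the domain are arbitrary. *)
Definition linear_on (l : (X -> F) -> F) :=
  (forall a u v, V u -> V v -> l (fun x => a * u x + v x) = a * l u + l v) /\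
  (forall u v, (forall x, D x -> u x = v x) -> l u = l v).

Definition free_on m (b : 'I_m -> X -> F) :=
  forall c : 'rV[F]_m,
    (forall x, D x -> \sum_i c 0 i * b i x = 0) -> c = 0.

Hypothesis VL : lincomb_closed.

Lemma lincomb_closed_sum (I : Type) (s : seq I) (c : I -> F) (b : I -> X -> F) :
  (forall i, V (b i)) -> V (fun x => \sum_(i <- s) c i * b i x).
Proof.
move=> Vb; elim: s => [|i s IH].
  by under eq_fun do rewrite big_nil; exact: VL.1.
by under eq_fun do rewrite big_cons; exact: VL.2.
Qed.

Lemma linear_on_sum l (I : Type) (s : seq I) (c : I -> F) (b : I -> X -> F) :
  linear_on l -> (forall i, V (b i)) ->
  l (fun x => \sum_(i <- s) c i * b i x) = \sum_(i <- s) c i * l (b i).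
Proof.
move=> [lL lE] Vb; elim: s => [|i s IH].
  rewrite big_nil; under eq_fun do rewrite big_nil.
  by have := lL (-1) _ _ VL.1 VL.1; rewrite mulr0 addr0 mulN1r addNr.
rewrite big_cons -IH; under eq_fun do rewrite big_cons.
by rewrite lL//; exact: lincomb_closed_sum.
Qed.

(** The functions [e j] need not belong to [V].  A free family of [V] has at most
    [#|J|] members, since its coordinate matrix on [e] has independent rows; a
    free family of maximal size is a basis. *)
Lemma finite_basis (J : finType) (e : J -> X -> F) :
  (forall v, V v -> exists c : J -> F,
     forall x, D x -> v x = \sum_j c j * e j x) ->
  exists m (b : 'I_m -> X -> F),
    [/\ forall i, V (b i), free_on b &
        forall v, V v -> exists c : 'rV[F]_m,
          forall x, D x -> v x = \sum_i c 0 i * b i x].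
Proof.
move=> spanV.
pose P m := `[< exists b : 'I_m -> X -> F, (forall i, V (b i)) /\ free_on b >].
have P0 : exists m, P m.
  exists 0%N; apply/asboolP; exists (fun=> fun=> 0); split; first by case.
  by move=> c _; apply/rowP; case.
have Pmax m : P m -> (m <= #|J|)%N.
  move=> /asboolP[b [Vb fb]].
  have /choice[C CE] : forall i, exists c : J -> F,
      forall x, D x -> b i x = \sum_j c j * e j x.
    by move=> i; exact: spanV.
  pose M : 'M[F]_(m, #|J|) := \matrix_(i, j) C i (enum_val j).
  suff /eqP <- : row_free M by exact: rank_leq_col.
  apply/row_freeP; apply/row_freeP; rewrite -kermx_eq0; apply/eqP/row_matrixP => r.
  rewrite row0; apply: fb => x Dx.
  set c := row r (kermx M).
  have cM : c *m M = 0 by rewrite -row_mul mulmx_ker row0.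
  transitivity (\sum_j (\sum_i c 0 i * C i j) * e j x).
    under [RHS]eq_bigr do rewrite mulr_suml.
    rewrite exchange_big/=; apply: eq_bigr => i _.
    by rewrite CE// mulr_sumr; apply: eq_bigr => j _; rewrite mulrA.
  apply: big1 => j _; rewrite [X in X * _](_ : _ = 0) ?mul0r//.
  transitivity ((c *m M) 0 (enum_rank j)); last by rewrite cM mxE.
  by rewrite mxE; apply: eq_bigr => i _; rewrite [M _ _]mxE enum_rankK.
case: (ex_maxnP P0 Pmax) => m /asboolP[b [Vb fb]] mmax.
exists m, b; split => // v Vv.
pose b' (i : 'I_(m + 1)) := match fintype.split i with inl j => b j | inr _ => v end.
have Vb' i : V (b' i) by rewrite /b'; case: fintype.split.
have sumb' (c : 'rV[F]_(m + 1)) x : \sum_i c 0 i * b' i x =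
    \sum_i c 0 (lshift 1 i) * b i x + c 0 (rshift m 0) * v x.
  rewrite big_split_ord/= big_ord1; congr (_ + _).
    by apply: eq_bigr => i _; rewrite /b' (unsplitK (inl i)).
  by rewrite /b' (unsplitK (inr 0)).
have nfree : ~ free_on b'.
  move=> fb'; suff /mmax : P (m + 1)%N by rewrite addn1 ltnn.
  by apply/asboolP; exists b'.
have [c [c0 cn0]] : exists c : 'rV[F]_(m + 1),
    (forall x, D x -> \sum_i c 0 i * b' i x = 0) /\ c <> 0.
  apply: contrapT => H; apply: nfree => c Hc; apply: contrapT => cn0.
  by apply: H; exists c.
(* Otherwise the relation [c] would already bind the free family [b]. *)
have cv : c 0 (rshift m 0) != 0.
  apply/eqP => cv; apply: cn0.
  have : (\row_i c 0 (lshift 1 i)) = 0 :> 'rV_m.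
    apply: fb => x Dx; rewrite -[RHS](c0 x Dx) sumb' cv mul0r addr0.
    by apply: eq_bigr => i _; rewrite mxE.
  move=> /rowP cl; apply/rowP => i; rewrite mxE.
  rewrite -(splitK i); case: fintype.split => j /=.
    by have := cl j; rewrite !mxE.
  by rewrite ord1.
exists (\row_i (- (c 0 (rshift m 0))^-1 * c 0 (lshift 1 i))) => x Dx.
have := c0 x Dx; rewrite sumb' => /(congr1 (fun z => (c 0 (rshift m 0))^-1 * z)).
rewrite mulr0 mulrDr mulKf// => /eqP; rewrite addrC addr_eq0 => /eqP ->.
rewrite mulr_sumr -sumrN; apply: eq_bigr => i _.
by rewrite mxE !mulNr mulrA.
Qed.

(** The last hypothesis says that the matrix of [B] on a basis has a trivial
    kernel; being square it is invertible, so the systems with the matrix and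
    with its transpose are both solvable. *)
Lemma bilinear_solve (J : finType) (e : J -> X -> F)
    (B : (X -> F) -> (X -> F) -> F) :
  (forall v, V v -> exists c : J -> F,
     forall x, D x -> v x = \sum_j c j * e j x) ->
  (forall v, V v -> linear_on (B ^~ v)) ->
  (forall u, V u -> linear_on (B u)) ->
  (forall v, V v -> (forall w, V w -> B w v = 0) ->
     forall x, D x -> v x = 0) ->
  [/\ forall l, linear_on l ->
        exists2 u, V u & forall v, V v -> B u v = l v,
      forall l, linear_on l ->
        exists2 v, V v & forall w, V w -> B w v = l w
    & forall u, V u -> (forall v, V v -> B u v = 0) ->
        forall x, D x -> u x = 0].
Proof.
move=> spanV Bl Br Binj.
have [m [b [Vb fb bE]]] := finite_basis spanV.
pose M : 'M[F]_m := \matrix_(i, j) B (b i) (b j).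
pose cb (c : 'rV[F]_m) x := \sum_i c 0 i * b i x.
have Vcb c : V (cb c) by exact: lincomb_closed_sum.
have lin_cb l c : linear_on l -> l (cb c) = \sum_i c 0 i * l (b i).
  by move=> ll; exact: linear_on_sum.
have lin0 l l' : linear_on l -> linear_on l' ->
    (forall i, l (b i) = l' (b i)) -> forall w, V w -> l w = l' w.
  move=> ll ll' llb w Vw; have [c wE] := bE w Vw.
  rewrite (ll.2 w (cb c))// (ll'.2 w (cb c))// !lin_cb//.
  by apply: eq_bigr => i _; rewrite llb.
have linc0 : linear_on (fun=> 0) by split => // *; rewrite mulr0 addr0.
have Mu : M \in unitmx.
  rewrite -unitmx_tr -row_free_unit -kermx_eq0; apply/eqP/row_matrixP => r.
  rewrite row0; apply: fb; set c := row r _.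
  have cM : c *m M^T = 0 by rewrite -row_mul mulmx_ker row0.
  apply: Binj (Vcb c) _; apply: lin0 => //; first exact: Bl.
  move=> i; rewrite lin_cb; last exact: Br.
  transitivity ((c *m M^T) 0 i); last by rewrite cM mxE.
  by rewrite mxE; apply: eq_bigr => j _; rewrite !mxE.
split=> [l ll|l ll|u Vu Bu0].
- pose c := (\row_i l (b i)) *m invmx M.
  exists (cb c) => //; apply: lin0 => //; first exact: Br.
  move=> i; rewrite (lin_cb (B ^~ (b i)))//; last exact: Bl.
  transitivity ((c *m M) 0 i); first by rewrite mxE; apply: eq_bigr => j _; rewrite !mxE.
  by rewrite /c mulmxKV// mxE.
- pose c := (\row_i l (b i)) *m (invmx M)^T.
  exists (cb c) => //; apply: lin0 => //; first exact: Bl.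
  move=> i; rewrite (lin_cb (B (b i)))//; last exact: Br.
  transitivity ((c *m M^T) 0 i); first by rewrite mxE; apply: eq_bigr => j _; rewrite !mxE.
  by rewrite /c -mulmxA -trmx_mul mulmxV// trmx1 mulmx1 mxE.
- have [c uE] := bE u Vu.
  suff c0 : c = 0 by move=> x Dx; rewrite uE// big1// => i _; rewrite c0 mxE mul0r.
  rewrite -(mulmxK Mu c) [c *m M](_ : _ = 0) ?mul0mx//.
  apply/rowP => i; rewrite [RHS]mxE -(Bu0 (b i))//.
  rewrite ((Bl _ (Vb i)).2 u (cb c))// (lin_cb (B ^~ (b i)))//; last exact: Bl.
  by rewrite mxE; apply: eq_bigr => j _; rewrite !mxE.
Qed.

End finite_dimension.

(** * Lebesgue measure on row vectors *)

Section euclidean_measure.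
Context {R : realType}.

Lemma rV_ballE n (x : 'rV[R]_n) e y :
  0 < e -> ball x e y <-> forall i, `|x 0 i - y 0 i| < e.
Proof.
move=> e0; split=> [[_ xy] i|xy]; first exact: xy.
by split => // i j; rewrite ord1; exact: xy.
Qed.

Definition cube n (M : R) : set 'rV[R]_n := [set x | forall i, `|x 0 i| <= M].
Arguments cube : clear implicits.

Lemma measurable_coord_preimage n i (Y : set R) :
  measurable Y -> measurable [set x : 'rV[R]_n | Y (x 0 i)].
Proof.
by move=> mY; have := measurable_coor i measurableT mY; rewrite setTI.
Qed.

Lemma measurable_rV_all n (Y : 'I_n -> set R) :
  (forall i, measurable (Y i)) ->
  measurable [set x : 'rV[R]_n | forall i, Y i (x 0 i)].
Proof.
move=> mY; rewrite (_ : [set _ | _] = \bigcap_i [set x : 'rV[R]_n | Y i (x 0 i)]).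
  by apply: fin_bigcap_measurable => // i _; exact: measurable_coord_preimage.
by apply/seteqP; split => [x Yx i _|x Yx i]; exact: Yx.
Qed.

Lemma measurable_rV_ball n (x : 'rV[R]_n) e : measurable (ball x e).
Proof.
have [e0|e0] := ltP 0 e; last first.
  rewrite (_ : ball x e = set0)//; apply/seteqP; split => // y [].
  by rewrite ltNge e0.
rewrite (_ : ball x e = [set y | forall i, ball (x 0 i) e (y 0 i)]).
  apply: (measurable_rV_all (Y := fun i => ball (x 0 i) e)) => i.
  by rewrite ball_itv; exact: measurable_itv.
by apply/seteqP; split => y /(rV_ballE _ _ e0).
Qed.

(** Open sets are measurable for the sigma-algebra generated by the coordinates,
    because countably many balls exhaust them.  The closed balls are kept inside
    [U] so that boxes taken from this cover have their closure in [U]. *)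
Lemma open_rV_rational_balls n (U : set 'rV[R]_n) : open U ->
  U = \bigcup_(p in [set p : 'rV[rat]_n * rat |
        [set y : 'rV[R]_n | forall i, `|ratr (p.1 0 i) - y 0 i| <= ratr p.2] `<=` U])
      ball (map_mx ratr p.1 : 'rV[R]_n) (ratr p.2 : R).
Proof.
move=> oU; apply/seteqP; split => [x Ux|x [p pU [_ px]]]; last first.
  by apply: pU => i; have /ltW := px 0 i; rewrite mxE.
have /nbhs_ballP[e /= e0 eU] : nbhs x U by exact: open_nbhs_nbhs.
(* Points of the closed ball of radius [r] about [q] are within [2 r < e] of [x]. *)
have [r] := rat_in_itvoo (divr_gt0 e0 (ltr0n _ 2)).
rewrite inE/= => /andP[r0 re].
have /choice[q qE] : forall i, exists q : rat, `|ratr q - x 0 i| < ratr r.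
  move=> i; have [|q] := @rat_in_itvoo R (x 0 i) (x 0 i + ratr r); first by rewrite ltrDl.
  rewrite inE/= => /andP[q1 q2]; exists q.
  by rewrite gtr0_norm ?subr_gt0// ltrBlDl.
exists (\row_i q i, r) => /=; last by apply/rV_ballE => // i; rewrite !mxE.
move=> y /= qy; apply: eU; apply/rV_ballE => // i.
rewrite -[x 0 i](subrK (ratr (q i))) -addrA (le_lt_trans (ler_normD _ _))//.
rewrite [ltRHS](splitr e) ltrD//; first by rewrite distrC (lt_trans (qE i)).
by have := qy i; rewrite mxE => /le_lt_trans; apply.
Qed.

Lemma open_rV_measurable n (U : set 'rV[R]_n) : open U -> measurable U.
Proof.
move=> /open_rV_rational_balls ->; rewrite bigcup_mkcond.
apply: countable_bigcupT_measurable; first exact: countableP.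
by move=> p; case: ifP => // _; exact: measurable_rV_ball.
Qed.

Lemma continuous_at_measurable n (Om : set 'rV[R]_n) (f : 'rV[R]_n -> R) :
  open Om -> (forall x, Om x -> {for x, continuous f}) ->
  measurable_fun Om f.
Proof.
move=> oOm cf; apply: (measurability _ (RGenOInfty.measurableE R)).
move=> _ [_ [a ->] <-]; apply: open_rV_measurable; rewrite openE => x [Omx fx].
apply: filterI; first exact: open_nbhs_nbhs.
by apply: (cf x Omx); exact: open_nbhs_nbhs.
Qed.

Lemma lebesgue_rVSE n : lebesgue_rV R n.+1 =
  pushforward (@lebesgue_measure R \x lebesgue_rV R n)%E (@rV_cons R n) :> (_ -> _).
Proof. by []. Qed.

(** The step of the recursion on the dimension: splitting off a coordinate turns
    a box into a rectangle of the product measure. *)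
Lemma rV_box_ind n (Y : 'I_n.+1 -> set R) :
  (@rV_cons R n) @^-1` [set x | forall i, Y i (x 0 i)] =
  Y ord0 `*` [set x : 'rV[R]_n | forall i, Y (lift ord0 i) (x 0 i)].
Proof.
apply/seteqP; split=> [p /= Yp|p [/= Y0 YS] i].
  split => /= [|i]; first by rewrite -[p.1]rV_cons0; exact: Yp.
  by rewrite -rV_consS; exact: Yp.
by case: (unliftP ord0 i) => [j ->|->]; rewrite ?rV_consS ?rV_cons0.
Qed.

Lemma lebesgue_rV_box n (Y : 'I_n -> set R) : (forall i, measurable (Y i)) ->
  lebesgue_rV R n [set x | forall i, Y i (x 0 i)] =
  (\prod_i lebesgue_measure (Y i))%E.
Proof.
elim: n Y => [|n IH] Y mY.
  rewrite big_ord0 /= diracE mem_set//=; by case.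
rewrite lebesgue_rVSE /pushforward rV_box_ind product_measure1E; last 2 first.
- exact: mY.
- by apply: (measurable_rV_all (Y := fun i => Y (lift ord0 i))) => i; exact: mY.
by rewrite big_ord_recl; congr (_ * _)%E; apply: (IH (fun i => Y (lift ord0 i))).
Qed.

Lemma cubeE n M : cube n M = [set x | forall i, `[- M, M]%classic (x 0 i)].
Proof.
by apply/seteqP; split => x xM i; have := xM i; rewrite /= in_itv/= ler_norml.
Qed.

Lemma cube_measurable n M : measurable (cube n M).
Proof.
by rewrite cubeE; apply: (measurable_rV_all (Y := fun=> `[- M, M]%classic)).
Qed.

Lemma cube_finite n M : (lebesgue_rV R n (cube n M) < +oo)%E.
Proof.
rewrite cubeE (lebesgue_rV_box (Y := fun=> `[- M, M]%classic))//.
rewrite big_const; elim: #|_| => [|k IH] /=; first exact: ltry.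
rewrite lte_mul_pinfty//; last by rewrite lebesgue_measure_itv; case: ifP => //=; rewrite ltry.
Qed.

Lemma open_rV_positive n (U : set 'rV[R]_n) :
  open U -> U !=set0 -> (0 < lebesgue_rV R n U)%E.
Proof.
move=> oU [x Ux].
have /nbhs_ballP[e /= e0 eU] : nbhs x U by exact: open_nbhs_nbhs.
apply: (@lt_le_trans _ _ (lebesgue_rV R n (ball x e))); last first.
  apply: le_measure => //; rewrite ?inE//; first exact: measurable_rV_ball.
  exact: open_rV_measurable.
rewrite (_ : ball x e = [set y | forall i, ball (x 0 i) e (y 0 i)]); last first.
  by apply/seteqP; split => y /(rV_ballE _ _ e0).
rewrite (lebesgue_rV_box (Y := fun i => ball (x 0 i) e))//; last first.
  by move=> i; rewrite ball_itv; exact: measurable_itv.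
apply: (big_ind (fun z => 0 < z)%E) => //; first exact: mule_gt0.
by move=> i _; rewrite lebesgue_measure_ball ?ltW// lte_fin mulrn_wgt0.
Qed.

(** The integrability criterion for test functions and their derivatives, on row
    vectors and on the product spaces on which Fubini is applied. *)
Lemma integrable_bounded_support d (T : measurableType d)
    (mu : {measure set T -> \bar R}) (K D : set T) (M : R) (f : T -> R) :
  measurable K -> measurable D -> (mu K < +oo)%E -> measurable_fun D f ->
  (forall x, `|f x| <= M) -> (forall x, ~ K x -> f x = 0) ->
  mu.-integrable D (EFin \o f).
Proof.
move=> mK mD muK mf fM f0.
apply: (@le_integrable _ _ _ mu D mD _ (EFin \o (fun x => M * \1_K x))).
- exact/measurable_EFinP.
- move=> x _ /=; rewrite lee_fin; have M0 : 0 <= M := le_trans (normr_ge0 _) (fM x).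
  have [xK|xK] := pselect (K x).
    rewrite indicE mem_set// mulr1; exact: le_trans (fM x) (ler_norm _).
  by rewrite f0// normr0.
- rewrite (_ : _ \o _ = (fun x => M%:E * (\1_K x)%:E)%E)//.
  apply: integrableZl => //; apply/integrableP; split.
    by apply/measurable_EFinP; exact: measurable_indic.
  under eq_integral do rewrite gee0_abs ?lee_fin//.
  rewrite integral_indic//; apply: le_lt_trans muK.
  by apply: le_measure; rewrite ?inE//; exact: measurableI.
Qed.

End euclidean_measure.
Arguments cube {R} n M.

(** * The L^2 inner product *)

Lemma discriminant_le (R : realFieldType) (a b c : R) :
  0 <= a -> (forall t, 0 <= t ^+ 2 * a + 2 * t * b + c) -> b ^+ 2 <= a * c.
Proof.
move=> a0 H.
have [az|an0] := eqVneq a 0.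
  rewrite az mul0r;  have [->|bn0] := eqVneq b 0; first by rewrite expr0n.
  (* The affine function [2 b t + c] takes the value [-1] here. *)
  exfalso; have := H (- (c + 1) / (2 * b)).
  suff -> : (2 * (- (c + 1) / (2 * b)) * b) = - (c + 1) by rewrite az mulr0 => ?; lra.
  by field.
have ap : 0 < a by rewrite lt0r an0.
(* The minimizer of the quadratic. *)
have := H (- b / a).
suff -> : (- b / a) ^+ 2 * a + 2 * (- b / a) * b + c = (a * c - b ^+ 2) / a.
  by rewrite pmulr_lge0 ?invr_gt0// subr_ge0.
by field.
Qed.

Section L2_theory.
Context {R : realType} {n : nat} (Om : set 'rV[R]_n).
Hypothesis mOm : measurable Om.
Implicit Types f g h : 'rV[R]_n -> R.
Local Notation mu := (lebesgue_rV R n).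
Local Notation inner := (inner Om).
Local Notation L2 := (L2 Om).
Local Notation normL2 := (normL2 Om).

(** Domination by [2 |f g| <= f ^ 2 + g ^ 2]. *)
Lemma L2_mul_integrable f g : L2 f -> L2 g ->
  mu.-integrable Om (EFin \o (fun x => f x * g x)).
Proof.
move=> [mf f2] [mg g2].
apply: (@le_integrable _ _ _ mu Om mOm _ (fun x => (f x ^+ 2)%:E + (g x ^+ 2)%:E)%E).
- by apply/measurable_EFinP; exact: measurable_funM.
- move=> x _ /=; rewrite lee_fin [leRHS]ger0_norm ?addr_ge0 ?sqr_ge0//.
  have := sqr_ge0 (`|f x| - `|g x|); rewrite normrM -[f x ^+ 2]real_normK ?num_real//.
  rewrite -[g x ^+ 2]real_normK ?num_real//.
  have := normr_ge0 (f x); have := normr_ge0 (g x); nra.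
- exact: integrableD.
Qed.

Lemma L2_bounded_mul f g M : L2 f -> measurable_fun Om g ->
  (forall x, Om x -> `|g x| <= M) -> L2 (fun x => g x * f x).
Proof.
move=> [mf f2] mg gM; split; first exact: measurable_funM.
apply: (@le_integrable _ _ _ mu Om mOm _ (fun x => (M ^+ 2)%:E * (f x ^+ 2)%:E)%E).
- by apply/measurable_EFinP; apply: measurable_funX; exact: measurable_funM.
- move=> x /gM gxM /=; rewrite lee_fin [leLHS]ger0_norm ?sqr_ge0//.
  rewrite [leRHS]ger0_norm; last by rewrite mulr_ge0// sqr_ge0.
  rewrite exprMn ler_wpM2r ?sqr_ge0// -[g x ^+ 2]real_normK ?num_real//.
  by rewrite lerXn2r// ?nnegrE// (le_trans _ gxM).
- exact: integrableZl.
Qed.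

Lemma L2_linear a f g : L2 f -> L2 g -> L2 (fun x => a * f x + g x).
Proof.
move=> f2 g2; split.
  by apply: measurable_funD; [apply: measurable_funM; [|exact: f2.1]|exact: g2.1].
rewrite (_ : (fun _ => _) = (fun x => (a ^+ 2)%:E * (f x * f x)%:E +
   ((2 * a)%:E * (f x * g x)%:E + (g x * g x)%:E))%E); last first.
  by apply/funext => x; rewrite -!EFinM -!EFinD; congr EFin; ring.
apply: integrableD => //; first by apply: integrableZl => //; exact: L2_mul_integrable.
apply: integrableD => //; last exact: L2_mul_integrable.
by apply: integrableZl => //; exact: L2_mul_integrable.
Qed.

Lemma L2_cst0 : L2 (fun=> 0).
Proof.
split; first exact: measurable_cst.
by under eq_fun do rewrite expr0n; exact: integrable0.
Qed.

Lemma innerC f g : inner f g = inner g f.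
Proof. by rewrite /inner; under eq_Rintegral do rewrite mulrC. Qed.

Lemma inner_linear a f g h : L2 f -> L2 g -> L2 h ->
  inner (fun x => a * f x + g x) h = a * inner f h + inner g h.
Proof.
move=> f2 g2 h2; rewrite /inner -RintegralZl//; last exact: L2_mul_integrable.
rewrite -RintegralD//; last 2 first.
- have := integrableZl mOm a (L2_mul_integrable f2 h2).
  by apply: eq_integrable => // x _ /=; rewrite EFinM.
- exact: L2_mul_integrable.
by apply: eq_Rintegral => x _; rewrite mulrDl mulrA.
Qed.

Lemma inner_linear_r a f g h : L2 f -> L2 g -> L2 h ->
  inner h (fun x => a * f x + g x) = a * inner h f + inner h g.
Proof. by move=> *; rewrite innerC inner_linear// ![inner h _]innerC. Qed.

Lemma inner0l g : inner (fun=> 0) g = 0.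
Proof.
rewrite /inner; under eq_Rintegral do rewrite mul0r.
by rewrite /Rintegral integral0_eq.
Qed.

Lemma inner_ge0 f : 0 <= inner f f.
Proof. by apply: Rintegral_ge0 => x _; rewrite -expr2 sqr_ge0. Qed.

Lemma normL2_sqr f : normL2 f ^+ 2 = inner f f.
Proof. by rewrite sqr_sqrtr// inner_ge0. Qed.

Lemma inner_eq f f' g g' : {in Om, f =1 f'} -> {in Om, g =1 g'} ->
  inner f g = inner f' g'.
Proof. by move=> ff' gg'; apply: eq_Rintegral => x Ox; rewrite ff'// gg'. Qed.

Lemma ae_eq_inner f f' g : L2 f -> L2 f' -> L2 g ->
  {ae mu, forall x, Om x -> f x = f' x} -> inner f g = inner f' g.
Proof.
move=> f2 f'2 g2 ff'; rewrite /inner /Rintegral; congr fine.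
apply: ae_eq_integral => //.
- by case/integrableP : (L2_mul_integrable f2 g2).
- by case/integrableP : (L2_mul_integrable f'2 g2).
- by apply: filterS ff' => x H /H ->.
Qed.

Lemma inner0_ae f : L2 f -> inner f f = 0 ->
  {ae mu, forall x, Om x -> f x = 0}.
Proof.
move=> f2 f0; have fi := L2_mul_integrable f2 f2.
have : (\int[mu]_(x in Om) `|(f x * f x)%:E| = 0)%E.
  under eq_integral do rewrite gee0_abs ?lee_fin -?expr2 ?sqr_ge0//.
  rewrite -[LHS]fineK; last by have := integrable_fin_num mOm fi.
  by congr EFin; rewrite -[RHS]f0.
move/(ae_eq_integral_abs mu mOm _).1 => /(_ _).
have mf : measurable_fun Om (fun x => (f x * f x)%:E) by case/integrableP : fi.
move=> /(_ mf); apply: filterS => x H /H [] /eqP.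
by rewrite mulf_eq0 orbb => /eqP.
Qed.

(** Families indexed by [J] stand for a function with its derivatives, so that
    this is Cauchy-Schwarz both in L^2 and in H^2. *)
Lemma inner_sum_CauchySchwarz (J : finType) (F G : J -> 'rV[R]_n -> R) :
  (forall j, L2 (F j)) -> (forall j, L2 (G j)) ->
  (\sum_j inner (F j) (G j)) ^+ 2 <=
  (\sum_j normL2 (F j) ^+ 2) * (\sum_j normL2 (G j) ^+ 2).
Proof.
move=> F2 G2; apply: discriminant_le => [|t]; first by apply: sumr_ge0 => j _; exact: sqr_ge0.
rewrite (_ : _ + _ = \sum_j inner (fun x => t * F j x + G j x)
                                  (fun x => t * F j x + G j x)).
  by apply: sumr_ge0 => j _; exact: inner_ge0.
rewrite !mulr_sumr -!big_split/=; apply: eq_bigr => j _.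
rewrite inner_linear ?inner_linear_r//; try exact: L2_linear.
by rewrite [inner (G j) (F j)]innerC !normL2_sqr; ring.
Qed.

Lemma inner_CauchySchwarz f g : L2 f -> L2 g ->
  inner f g <= normL2 f * normL2 g.
Proof.
move=> f2 g2.
have := @inner_sum_CauchySchwarz unit (fun=> f) (fun=> g) (fun=> f2) (fun=> g2).
rewrite !big_const card_unit/= !addr0 -exprMn => H.
apply: le_trans (ler_norm _) _.
by rewrite -(@ler_pXn2r _ 2)// ?nnegrE ?mulr_ge0 ?sqrtr_ge0// real_normK ?num_real.
Qed.

(** A parallelogram bound: it replaces the triangle inequality where only
    convergence to zero matters. *)
Lemma normL2_linear_le a f g : L2 f -> L2 g ->
  normL2 (fun x => a * f x + g x) ^+ 2 <=
  2 * a ^+ 2 * normL2 f ^+ 2 + 2 * normL2 g ^+ 2.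
Proof.
move=> f2 g2; have := inner_ge0 (fun x => - a * f x + g x).
rewrite !normL2_sqr !inner_linear ?inner_linear_r//; try exact: L2_linear.
rewrite [inner g f]innerC; lra.
Qed.

End L2_theory.

(** * Functions that are flat at the origin *)

Section flat.
Context {R : realType}.
Implicit Types (P : {poly R}) (x y : R).

Lemma cvg_is_derive (V W : normedModType R) (f : V -> W) (x v : V) (l : W) :
  h^-1 *: (f (h *: v + x) - f x) @[h --> (0:R)^'] --> l -> is_derive x v f l.
Proof.
move=> fl; apply: DeriveDef; last exact: cvg_lim fl.
by apply/cvg_ex; exists l.
Qed.

(** The polynomial factor makes this class stable under differentiation, so that
    smoothness follows from one computation of a derivative. *)
Definition flat P x := if 0 < x then P.[x^-1] * expR (- x^-1) else 0.

Lemma exp_monomial_le (y : R) i : 0 < y ->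
  y ^+ i * expR (- y) <= i.+1`!%:R * y^-1.
Proof.
move=> y0; have f0 : 0 < i.+1`!%:R :> R by rewrite ltr0n fact_gt0.
have : y ^+ i.+1 / i.+1`!%:R <= expR y.
  by apply: le_trans (expR_ge1Dxn i (ltW y0)); rewrite lerDr.
rewrite ler_pdivrMr// expRN ler_pdivlMr// => H.
rewrite mulrAC -exprSr ler_pdivrMr ?expR_gt0//.
by rewrite mulrC.
Qed.

(** With [y = 1 / x], a monomial [y ^ i] loses to the exponential by the factor
    [1 / y]; this linear bound is all that differentiability at [0] needs. *)
Lemma flat_le P : exists2 C, 0 <= C & forall x, `|flat P x| <= C * `|x|.
Proof.
exists (\sum_(i < size P) `|P`_i| * i.+1`!%:R) => [|x].
  by apply: sumr_ge0 => i _; rewrite mulr_ge0.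
rewrite /flat; case: ifPn => x0; last first.
  by rewrite normr0 mulr_ge0// sumr_ge0// => i _; rewrite mulr_ge0.
rewrite horner_coef normrM [`|expR _|]gtr0_norm ?expR_gt0// [`|x|]gtr0_norm//.
apply: (@le_trans _ _ ((\sum_(i < size P) `|P`_i| * x^-1 ^+ i) * expR (- x^-1))).
  rewrite ler_pM2r ?expR_gt0//; apply: le_trans (ler_norm_sum _ _ _) _.
  apply: ler_sum => i _; rewrite normrM [`|x^-1 ^+ _|]ger0_norm//.
  by rewrite exprn_ge0// invr_ge0 ltW.
rewrite !mulr_suml; apply: ler_sum => i _; rewrite -!mulrA ler_wpM2l//.
by have := @exp_monomial_le x^-1 i; rewrite invrK; apply; rewrite invr_gt0.
Qed.

Lemma flat_quotient P x : x^-1 * flat P x = flat ('X * P) x.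
Proof. by rewrite /flat; case: ifP => _; rewrite ?mulr0// hornerM hornerX mulrA. Qed.

(** At [0] the difference quotient of [flat P] is [flat ('X * P)], which tends to
    [0] linearly. *)
Lemma is_derive_flat P x : is_derive x 1 (flat P) (flat ('X^2 * (P - P^`())) x).
Proof.
have [x0|x0|->] := ltgtP x 0.
- rewrite [X in is_derive _ _ _ X]/flat lt_gtF//; apply: (@near_eq_is_derive _ _ _ (cst 0)).
  near=> y; rewrite /flat ifF//; apply/negbTE; rewrite -leNgt ltW//.
  by near: y; exact: lt_nbhsl.
- rewrite [X in is_derive _ _ _ X]/flat x0.
  apply: (@near_eq_is_derive _ _ _ (fun y => P.[y^-1] * expR (- y^-1))).
    near=> y; rewrite /flat ifT//; near: y; exact: lt_nbhsr.
  have dV : is_derive x 1 (fun y : R => y^-1) (- x ^- 2 *: 1).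
    by apply: is_deriveV; rewrite gt_eqF.
  have dN : is_derive x 1 (fun y : R => - y^-1) (- (- x ^- 2 *: 1)) by exact: is_deriveN.
  have dE := @is_derive1_comp _ expR (fun y : R => - y^-1) x _ _ (is_derive_expR _) dN.
  have dP := @is_derive1_comp _ (horner P) (fun y : R => y^-1) x _ _ (is_derive_poly P _) dV.
  apply: (is_derive_eq (is_deriveM dP dE)); rewrite !(hornerE, hornerXn)/= exprVn.
  have xn0 : x != 0 by rewrite gt_eqF.
  rewrite /GRing.scale/=; by field.
- have -> : flat ('X^2 * (P - P^`())) 0 = 0 by rewrite /flat ltxx.
  apply: cvg_is_derive.
  have [C C0 CP] := flat_le ('X * P).
  apply/cvgr0Pnorm_lt => e e0; near=> h.
  rewrite [X in _ - X]/flat ltxx subr0 addr0 /GRing.scale/= mulr1 flat_quotient.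
  apply: le_lt_trans (CP h) _.
  apply: (@le_lt_trans _ _ ((C + 1) * `|h|)); first by rewrite ler_wpM2r// lerDl.
  rewrite mulrC -ltr_pdivlMr; last by rewrite ltr_wpDl.
  near: h; apply: dnbhs0_lt; rewrite divr_gt0// ltr_wpDl//.
Unshelve. all: by end_near. Qed.

Lemma continuous_flat P : continuous (flat P).
Proof.
move=> x; apply: differentiable_continuous; apply/derivable1_diffP.
by have [] := is_derive_flat P x.
Qed.

Lemma flat1E x : 0 < x -> flat 1 x = expR (- x^-1).
Proof. by move=> x0; rewrite /flat x0 hornerC mul1r. Qed.

Lemma flat1_eq0 x : x <= 0 -> flat 1 x = 0.
Proof. by rewrite /flat ltNge => ->. Qed.

Lemma flat1_itv x : 0 <= flat 1 x <= 1.
Proof.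
have [x0|x0] := ltP 0 x; last by rewrite flat1_eq0// lexx ler01.
by rewrite flat1E// expR_ge0 -[leRHS]expR0 ler_expR oppr_le0 invr_ge0 ltW.
Qed.

Lemma cvg_flat1 x : 0 < x -> flat 1 (k.+1%:R * x) @[k --> \oo] --> (1 : R).
Proof.
move=> x0; under eq_fun do rewrite flat1E ?mulr_gt0// invfM.
have hx : - (k.+1%:R^-1 * x^-1) @[k --> \oo] --> (0 : R).
  rewrite -[X in _ --> X]oppr0; apply: cvgN.
  rewrite -[X in _ --> X](mul0r x^-1); apply: cvgMl; exact: cvg_harmonic.
have := continuous_cvg _ (@continuous_expR R 0) hx; rewrite expR0; exact.
Qed.

End flat.

(** * Smooth bump functions on boxes *)

Section bump_functions.
Context {R : realType} {n : nat}.
Local Notation E := 'rV[R]_n.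
Implicit Types (f g : E -> R) (x : E).

(** The algebra generated by the flat functions of affine functions of one
    coordinate: it is closed under partial derivatives and made of continuous
    functions, hence of smooth ones. *)
Inductive flat_polynomial : (E -> R) -> Prop :=
| flat_polynomial_cst a : flat_polynomial (fun=> a)
| flat_polynomial_flat P i c d :
    flat_polynomial (fun x => flat P (c * x 0 i + d))
| flat_polynomial_add f g : flat_polynomial f -> flat_polynomial g ->
    flat_polynomial (fun x => f x + g x)
| flat_polynomial_mul f g : flat_polynomial f -> flat_polynomial g ->
    flat_polynomial (fun x => f x * g x).

Lemma continuous_coord i : continuous (fun x : E => x 0 i).
Proof. exact: coord_continuous. Qed.

Lemma is_derive_coord (F : R -> R) (i j : 'I_n) x l :
  is_derive (x 0 i) 1 F l ->
  is_derive x (delta_mx 0 j) (fun y => F (y 0 i)) ((i == j)%:R * l).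
Proof.
move=> dF; apply: cvg_is_derive.
have [ij|ij] := eqVneq i j.
  move: dF; rewrite mul1r ij => -[dF1 <-].
  rewrite (_ : (fun _ => _) = (fun h => h^-1 *: (F (h *: 1 + x 0 j) - F (x 0 j)))).
    exact: dF1.
  apply/funext => h; congr (_ *: (F _ - _)).
  by rewrite !mxE !eqxx.
rewrite mul0r (_ : (fun _ => _) = (fun=> 0)); first exact: cvg_cst.
apply/funext => h; rewrite !mxE eqxx (negbTE ij) /= mulr0 add0r subrr.
by rewrite scaler0.
Qed.

Lemma flat_polynomial_continuous f : flat_polynomial f -> continuous f.
Proof.
elim=> {f} [a|P i c d|f g _ cf _ cg|f g _ cf _ cg] x.
- exact: cst_continuous.
- apply: (@continuous_comp _ _ _ (fun y : E => c * y 0 i + d) (flat P)).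
    apply: continuousD; last exact: cst_continuous.
    by apply: continuousM; [exact: cst_continuous|exact: continuous_coord].
  exact: continuous_flat.
- by apply: continuousD; [exact: cf|exact: cg].
- by apply: continuousM; [exact: cf|exact: cg].
Qed.

Lemma flat_polynomial_derive f i : flat_polynomial f ->
  exists2 g, flat_polynomial g &
    forall x, is_derive x (delta_mx 0 i) f (g x).
Proof.
elim=> {f} [a|P j c d|f g _ [f' F' df] _ [g' G' dg]|f g F [f' F' df] G [g' G' dg]].
- exists (fun=> 0) => [|x]; [exact: flat_polynomial_cst|exact: is_derive_cst].
- exists (fun x => ((j == i)%:R * c) * flat ('X^2 * (P - P^`())) (c * x 0 j + d)).
    by apply: flat_polynomial_mul; [exact: flat_polynomial_cst|exact: flat_polynomial_flat].
  move=> x; rewrite -mulrA.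
  apply: (@is_derive_coord (fun t => flat P (c * t + d))).
  have dA : is_derive (x 0 j) 1 (fun t : R => c * t + d) (c *: 1 + 0).
    apply: is_deriveD.
  have dF := @is_derive1_comp _ (flat P) _ _ _ _ (is_derive_flat P _) dA.
  by apply: (is_derive_eq dF); rewrite addr0 /GRing.scale/= mulr1 mulrC.
- exists (fun x => f' x + g' x); first exact: flat_polynomial_add.
  by move=> x; apply: is_deriveD.
- exists (fun x => f x * g' x + g x * f' x).
    by apply: flat_polynomial_add; exact: flat_polynomial_mul.
  by move=> x; apply: is_deriveM.
Qed.

Lemma flat_polynomial_partials f s :
  flat_polynomial f -> flat_polynomial (partials s f).
Proof.
move=> Ff; elim: s => //= i s /(flat_polynomial_derive i)[g Fg dg].
rewrite (_ : partial _ _ = g)//; apply/funext => x.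
by have [] := dg x.
Qed.

Lemma flat_polynomial_smooth f : flat_polynomial f -> smooth f.
Proof.
move=> Ff s; have Fs := flat_polynomial_partials s Ff; split.
  exact: flat_polynomial_continuous.
by move=> i x; have [g _ /(_ x)[]] := flat_polynomial_derive i Fs.
Qed.

Definition open_box (a b : E) : set E :=
  [set x | forall i, a 0 i < x 0 i < b 0 i].

Definition closed_box (a b : E) : set E :=
  [set x | forall i, a 0 i <= x 0 i <= b 0 i].

(** Each factor is [exp (- 1 / ((k + 1) t))] where [t], the distance to a face,
    is positive, and [0] elsewhere; it increases to [1] with [k]. *)
Definition bump (a b : E) (k : nat) x : R :=
  \prod_i (flat 1 (k.+1%:R * (x 0 i - a 0 i)) * flat 1 (k.+1%:R * (b 0 i - x 0 i))).

Lemma closed_box_compact a b : compact (closed_box a b).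
Proof.
rewrite (_ : closed_box a b = [set x | forall i, `[a 0 i, b 0 i]%classic (x 0 i)]).
  by apply: (@rV_compact _ _ (fun i => `[a 0 i, b 0 i]%classic)) => i; exact: segment_compact.
by apply/seteqP; split=> x bx i; have := bx i; rewrite /= in_itv.
Qed.

Lemma open_box_measurable a b : measurable (open_box a b).
Proof.
rewrite (_ : open_box a b = [set x | forall i, `]a 0 i, b 0 i[%classic (x 0 i)]).
  by apply: (measurable_rV_all (Y := fun i => `]a 0 i, b 0 i[%classic)).
by apply/seteqP; split=> x bx i; have := bx i; rewrite /= in_itv.
Qed.

Lemma bump_itv a b k x : 0 <= bump a b k x <= 1.
Proof.
apply/andP; split.
  apply: prodr_ge0 => i _; rewrite mulr_ge0//.
    by have /andP[] := flat1_itv (k.+1%:R * (x 0 i - a 0 i)).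
  by have /andP[] := flat1_itv (k.+1%:R * (b 0 i - x 0 i)).
apply: numdomain.Num.Theory.prodr_ile1 => i _.
have /andP[? ?] := flat1_itv (k.+1%:R * (x 0 i - a 0 i)).
have /andP[? ?] := flat1_itv (k.+1%:R * (b 0 i - x 0 i)).
by rewrite mulr_ge0//= mulr_ile1.
Qed.

Lemma bump_eq0 a b k x : ~ open_box a b x -> bump a b k x = 0.
Proof.
move=> /existsNP[i] /negP; rewrite negb_and -!leNgt => ab.
apply/eqP; rewrite /bump prodf_seq_eq0; apply/hasP; exists i; first exact: mem_index_enum.
rewrite /= mulf_eq0; case/orP : ab => ab.
  by rewrite flat1_eq0 ?eqxx// pmulr_rle0// subr_le0.
by rewrite [X in _ || (X == 0)]flat1_eq0 ?eqxx ?orbT// pmulr_rle0// subr_le0.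
Qed.

Lemma cvg_bump a b x :
  bump a b k x @[k --> \oo] --> (\1_(open_box a b) x : R).
Proof.
rewrite indicE; have [abx|abx] := pselect (open_box a b x); last first.
  rewrite memNset//; under eq_fun do rewrite bump_eq0//; exact: cvg_cst.
rewrite mem_set// /bump /=.
elim: (index_enum _) => [|i s IH].
  under eq_fun do rewrite big_nil; exact: cvg_cst.
under eq_fun do rewrite big_cons.
have /andP[ai ib] := abx i.
have ai0 : 0 < x 0 i - a 0 i by rewrite subr_gt0.
have bi0 : 0 < b 0 i - x 0 i by rewrite subr_gt0.
have := cvgM (cvgM (cvg_flat1 ai0) (cvg_flat1 bi0)) IH.
by rewrite !mulr1; exact.
Qed.

Lemma bump_smooth a b k : smooth (bump a b k).
Proof.
apply: flat_polynomial_smooth; rewrite /bump.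
elim: (index_enum _) => [|i s IH].
  by under eq_fun do rewrite big_nil; exact: flat_polynomial_cst.
under eq_fun do rewrite big_cons.
apply: flat_polynomial_mul => //; apply: flat_polynomial_mul.
  under eq_fun do rewrite mulrBr -mulrN; exact: flat_polynomial_flat.
under eq_fun do rewrite mulrBr addrC -mulNr; exact: flat_polynomial_flat.
Qed.

Lemma bump_test_function (Om : set E) a b k :
  closed_box a b `<=` Om -> test_function Om (bump a b k).
Proof.
move=> abOm; split; first exact: bump_smooth.
exists (closed_box a b); split=> //; first exact: closed_box_compact.
move=> x nx; apply: bump_eq0 => ox; apply: nx => i.
by have /andP[/ltW -> /ltW ->] := ox i.
Qed.

End bump_functions.

(** * The integral of a partial derivative *)

Section divergence.
Context {R : realType}.

(** A directional derivative depends only on the restriction to a line: this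
    transfers derivatives to the slices of a function of several variables. *)
Lemma is_derive_line (V V' W : normedModType R) (F : V -> W) (G : V' -> W)
    (x v : V) (y w : V') (l : W) :
  (forall h : R, G (h *: w + y) = F (h *: v + x)) ->
  is_derive x v F l -> is_derive y w G l.
Proof.
move=> GF [dF <-]; apply: cvg_is_derive.
have GF0 : G y = F x by have := GF 0; rewrite !scale0r !add0r.
by under eq_fun do rewrite GF GF0; exact: dF.
Qed.

Lemma partial_is_derive n (F : 'rV[R]_n -> R) i x :
  derivable F x (delta_mx 0 i) -> is_derive x (delta_mx 0 i) F (partial i F x).
Proof. by move=> dF; exact: derivableP. Qed.

Lemma cube_compact n M : compact (cube n M : set 'rV[R]_n).
Proof.
rewrite cubeE; apply: (@rV_compact _ _ (fun=> `[- M, M]%classic)) => _.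
exact: segment_compact.
Qed.

Lemma closed_cube n M : closed (cube n M : set 'rV[R]_n).
Proof.
by apply: compact_closed; [exact: norm_hausdorff|exact: cube_compact].
Qed.

Lemma partial_eq0 n (F : 'rV[R]_n -> R) i (K : set 'rV[R]_n) x :
  closed K -> (forall x, ~ K x -> F x = 0) -> ~ K x -> partial i F x = 0.
Proof.
move=> cK F0 Kx; rewrite /partial.
rewrite (@near_eq_derive _ _ _ _ (cst 0)) ?derive_cst//.
have : nbhs x (~` K) by apply: open_nbhs_nbhs; split => //; exact: closed_openC.
by apply: filterS => y /F0.
Qed.

Lemma bounded_in_cube n (K : set 'rV[R]_n) : bounded_set K ->
  exists2 M, 0 < M & K `<=` cube n M.
Proof.
move=> [M [_ KM]].
have M1 : M < `|M| + 1 by rewrite (le_lt_trans (ler_norm _))// ltrDl.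
have M2 : 0 < `|M| + 2 by rewrite ltr_wpDl.
exists (`|M| + 2) => //.
move=> x /(KM _ M1) xM i; have : ball 0 (`|M| + 2) x.
  by rewrite -ball_normE /= sub0r normrN (le_lt_trans xM)// ltrD2l ltr1n.
by move=> /(rV_ballE _ _ M2)/(_ i); rewrite mxE sub0r normrN => /ltW.
Qed.

Lemma continuous_support_bounded n (F : 'rV[R]_n -> R) M : continuous F ->
  (forall x, ~ cube n M x -> F x = 0) -> exists B, forall x, `|F x| <= B.
Proof.
move=> cF F0; have cK : compact (cube n M : set 'rV[R]_n) by exact: cube_compact.
have : compact (F @` cube n M).
  by apply: continuous_compact cK; exact: continuous_subspaceT.
move=> /compact_bounded[B [_ KB]]; exists (`|B| + 1) => x.
have [xK|/F0 ->] := pselect (cube n M x); last by rewrite normr0 addr_ge0.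
apply: (KB (`|B| + 1)); last by exists x.
by rewrite (le_lt_trans (ler_norm _))// ltrDl.
Qed.

Lemma continuous_rV_measurable n (F : 'rV[R]_n -> R) :
  continuous F -> measurable_fun setT F.
Proof.
by move=> cF; apply: continuous_at_measurable; [exact: openT|move=> x _; exact: cF].
Qed.

Lemma rV_cons_line0 n (h t : R) (y : 'rV[R]_n) :
  rV_cons (h *: 1 + t, y) = h *: delta_mx 0 ord0 + rV_cons (t, y).
Proof.
apply/rowP => i; rewrite [RHS]mxE [(_ *: delta_mx _ _) _ _]mxE [delta_mx _ _ _ _]mxE.
case: (unliftP ord0 i) => [j ->|->].
  by rewrite !rV_consS/= mulr0 add0r.
by rewrite !rV_cons0.
Qed.

Lemma rV_cons_lineS n (h t : R) (y : 'rV[R]_n) j :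
  rV_cons (t, h *: delta_mx 0 j + y) =
  h *: delta_mx 0 (lift ord0 j) + rV_cons (t, y).
Proof.
apply/rowP => i; rewrite [RHS]mxE [(_ *: delta_mx _ _) _ _]mxE [delta_mx _ _ _ _]mxE.
case: (unliftP ord0 i) => [k ->|->].
  by rewrite !rV_consS/= !mxE (inj_eq lift_inj).
by rewrite !rV_cons0/= mulr0 add0r.
Qed.

Lemma continuous_rV_consl n (y : 'rV[R]_n) : continuous (fun t => rV_cons (t, y)).
Proof.
move=> t; apply/cvg_ballP => e e0; near=> s.
apply/rV_ballE => // i; case: (unliftP ord0 i) => [j ->|->].
  by rewrite !rV_consS/= subrr normr0.
rewrite !rV_cons0/=; near: s; exact: (nbhsx_ballx t _ e0).
Unshelve. all: by end_near. Qed.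

Lemma continuous_rV_consr n (t : R) : continuous (fun y : 'rV[R]_n => rV_cons (t, y)).
Proof.
move=> y U /nbhs_ballP[e /= e0 eU].
apply: (@filterS _ (nbhs y) _ _ _ _ (nbhsx_ballx y _ e0)) => z yz.
apply: eU; apply/rV_ballE => // i; case: (unliftP ord0 i) => [j ->|->].
  by have /(rV_ballE _ _ e0)/(_ j) := yz; rewrite !rV_consS.
by rewrite !rV_cons0/= subrr normr0.
Qed.

(** Induction on the dimension.  For the first coordinate, integrate over it
    first and apply the fundamental theorem of calculus on an interval whose
    endpoints lie outside the support; for any other coordinate, integrate first
    over the remaining ones and use the induction hypothesis on each slice. *)
Lemma integral_partial_eq0 n (F : 'rV[R]_n -> R) i M :
  (forall x, derivable F x (delta_mx 0 i)) -> continuous (partial i F) ->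
  (forall x, ~ cube n M x -> F x = 0) ->
  (\int[lebesgue_rV R n]_x (partial i F x)%:E = 0)%E.
Proof.
elim: n F i => [F []//|n IH] F i dF cdF F0.
have dF0 x : ~ cube n.+1 M x -> partial i F x = 0.
  by apply: partial_eq0 F0; exact: closed_cube.
have [B FB] := continuous_support_bounded cdF dF0.
have mdF := continuous_rV_measurable cdF.
have icons : (@lebesgue_measure R \x lebesgue_rV R n)%E.-integrable setT
    (EFin \o (fun p => partial i F (rV_cons p))).
  apply: (@integrable_bounded_support R _ _ (@lebesgue_measure R \x lebesgue_rV R n)%E
    (@rV_cons R n @^-1` cube n.+1 M) setT B (fun p => partial i F (rV_cons p))) => //.
  - by have := measurable_rV_cons measurableT (@cube_measurable R n.+1 M); rewrite setTI.
  - exact: (@cube_finite R n.+1 M).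
  - by apply: (measurableT_comp mdF); exact: measurable_rV_cons.
  - by move=> x xM; apply: dF0.
rewrite lebesgue_rVSE integral_pushforward//; last 2 first.
- exact: measurable_rV_cons.
- exact/measurable_EFinP.
rewrite preimage_setT.
case: (unliftP ord0 i) => [j ij|i0].
  rewrite -integral12_prod_meas1//; apply: integral0_eq => t _.
  rewrite /fubini_F /=.
  have dG (y : 'rV[R]_n) : is_derive y (delta_mx 0 j) (fun y => F (rV_cons (t, y)))
      (partial i F (rV_cons (t, y))).
    apply: is_derive_line (partial_is_derive (dF (rV_cons (t, y)))) => h.
    by rewrite ij rV_cons_lineS.
  rewrite -[RHS](IH (fun y => F (rV_cons (t, y))) j).
  - by apply: eq_integral => y _; congr EFin; case: (dG y) => _ /esym.
  - by move=> y; have [] := dG y.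
  - rewrite (_ : partial _ _ = partial i F \o (fun y => rV_cons (t, y))).
      by move=> y; apply: continuous_comp; [exact: continuous_rV_consr|exact: cdF].
    by apply/funext => y; case: (dG y).
  - move=> y yM; apply: F0 => tyM; apply: yM => k.
    by have := tyM (lift ord0 k); rewrite rV_consS.
rewrite -integral21_prod_meas1//; apply: integral0_eq => y _.
rewrite /fubini_G /=.
have dG (t : R) : is_derive t 1 (fun t => F (rV_cons (t, y)))
    (partial i F (rV_cons (t, y))).
  apply: is_derive_line (partial_is_derive (dF (rV_cons (t, y)))) => h.
  by rewrite i0 rV_cons_line0.
have out t : M < `|t| -> ~ cube n.+1 M (rV_cons (t, y)).
  by move=> Mt /(_ ord0); rewrite rV_cons0/= leNgt Mt.
pose b : R := `|M| + 1.
have Mb : M < b by rewrite (le_lt_trans (ler_norm _))// ltrDl.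
have b0 : 0 < b by rewrite ltr_wpDl.
have cG t : {for t, continuous (fun t => F (rV_cons (t, y)))}.
  apply: differentiable_continuous; apply/derivable1_diffP.
  by have [] := dG t.
transitivity (\int[lebesgue_measure]_(t in `[(- b)%R, b]) (partial i F (rV_cons (t, y)))%:E)%E.
  rewrite [RHS]integral_mkcond; apply: eq_integral => t _; rewrite patchE.
  case: ifPn => //; rewrite notin_setE/= in_itv/= -ler_norml => /negP.
  by rewrite -ltNge => bt; rewrite dF0//; apply: out; exact: lt_trans bt.
rewrite (@continuous_FTC2 _ _ (fun t => F (rV_cons (t, y)))).
- rewrite !F0 ?subee//; apply: out; rewrite ?normrN gtr0_norm//.
- by rewrite gtrN.
- apply: continuous_subspaceT => t.
  by apply: continuous_comp; [exact: continuous_rV_consl|exact: cdF].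
- split.
  + by move=> t _; have [] := dG t.
  + by apply: cvg_at_right_filter; exact: cG.
  + by apply: cvg_at_left_filter; exact: cG.
- by move=> t _; rewrite derive1E; case: (dG t).
Qed.

End divergence.

(** * Test functions *)

Section test_functions.
Context {R : realType} {n : nat} (Om : set 'rV[R]_n).
Hypothesis oOm : open Om.
Local Notation E := 'rV[R]_n.
Local Notation mu := (lebesgue_rV R n).
Implicit Types (f g phi psi : E -> R).

Let mOm : measurable Om := open_rV_measurable oOm.

Lemma test_function_continuous phi : test_function Om phi -> continuous phi.
Proof. by move=> [/(_ [::])[]]. Qed.

Lemma test_function_is_derive phi i x : test_function Om phi ->
  is_derive x (delta_mx 0 i) phi (partial i phi x).
Proof. by move=> [/(_ [::])[_ d] _]; exact/partial_is_derive/d. Qed.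

Lemma test_function_cube phi : test_function Om phi ->
  exists M, forall x, ~ cube n M x -> phi x = 0.
Proof.
move=> [_ [K [cK _ K0]]]; have [M _ KM] := bounded_in_cube (compact_bounded cK).
by exists M => x xM; apply: K0 => /KM.
Qed.

Lemma test_function_out phi x : test_function Om phi -> ~ Om x -> phi x = 0.
Proof. by move=> [_ [K [_ KO K0]]] nO; apply: K0 => /KO. Qed.

Lemma test_function_partial phi i :
  test_function Om phi -> test_function Om (partial i phi).
Proof.
move=> [sphi [K [cK KO K0]]]; split.
  move=> s; have := sphi (s ++ [:: i]).
  by rewrite /partials foldr_cat.
exists K; split => // x Kx; apply: partial_eq0 K0 Kx.
by apply: compact_closed cK; exact: norm_hausdorff.
Qed.

Lemma test_function_partials phi s :
  test_function Om phi -> test_function Om (partials s phi).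
Proof. by move=> tphi; elim: s => //= i s; exact: test_function_partial. Qed.

Lemma test_function0 : test_function Om (fun=> 0).
Proof.
split; last by exists set0; split => //; exact: compact0.
suff H s : partials s (fun _ : E => 0 : R) = (fun=> 0).
  move=> s; rewrite H; split => [x|i x]; first exact: cst_continuous.
  exact: derivable_cst.
elim: s => //= i s ->; apply/funext => x; exact: derive_cst.
Qed.

Lemma test_function_linear a phi psi :
  test_function Om phi -> test_function Om psi ->
  test_function Om (fun x => a * phi x + psi x).
Proof.
move=> tphi tpsi.
have d f g i x : test_function Om f -> test_function Om g ->
    is_derive x (delta_mx 0 i) (fun x => a * f x + g x)
      (a * partial i f x + partial i g x).
  move=> tf tg; apply: is_deriveD.
    by apply: is_deriveZ; exact: test_function_is_derive.
  exact: test_function_is_derive.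
have pE s : partials s (fun x => a * phi x + psi x) =
    (fun x => a * partials s phi x + partials s psi x).
  elim: s => //= i s ->; apply/funext => x.
  by case: (d _ _ i x (test_function_partials s tphi) (test_function_partials s tpsi)).
split=> [s|].
  have ts := test_function_partials s tphi.
  have ts' := test_function_partials s tpsi.
  rewrite pE; split => [x|i x]; last by have [] := d _ _ i x ts ts'.
  apply: (@continuousD _ _ _ (fun x : E => a * partials s phi x) (partials s psi)).
    by apply: (@continuousM _ _ (fun _ : E => a) (partials s phi));
      [exact: cst_continuous|exact: test_function_continuous].
  exact: test_function_continuous.
case: tphi => _ [K [cK KO K0]]; case: tpsi => _ [L [cL LO L0]].
exists (K `|` L); split; first exact: compactU.
  by move=> x [/KO|/LO].
move=> x /not_orP[/K0 -> /L0 ->]; by rewrite mulr0 addr0.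
Qed.

Lemma test_function_L2 phi : test_function Om phi -> L2 Om phi.
Proof.
move=> tphi; have cphi := test_function_continuous tphi.
have [M phi0] := test_function_cube tphi.
have [B phiB] := continuous_support_bounded cphi phi0.
have mphi : measurable_fun Om phi.
  by apply: measurable_funTS; exact: continuous_rV_measurable.
split => //; apply: (@integrable_bounded_support _ _ _ mu (cube n M) Om (B ^+ 2)
   (fun x => phi x ^+ 2)) => //.
- exact: cube_measurable.
- exact: cube_finite.
- exact: measurable_funX.
- move=> x; rewrite normrX lerXn2r// nnegrE//; exact: le_trans (phiB x).
- by move=> x /phi0 ->; rewrite expr0n.
Qed.

(** The product rule turns the sum of both sides into the integral over the whole
    space of a partial derivative with compact support. *)
Lemma test_function_by_parts phi psi i :
  test_function Om phi -> test_function Om psi ->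
  inner Om phi (partial i psi) = - inner Om (partial i phi) psi.
Proof.
move=> tphi tpsi; apply/eqP; rewrite -addr_eq0; apply/eqP.
have tphi' := test_function_partial i tphi.
have tpsi' := test_function_partial i tpsi.
rewrite /inner -RintegralD//; last 2 first.
- by apply: L2_mul_integrable => //; exact: test_function_L2.
- by apply: L2_mul_integrable => //; exact: test_function_L2.
have d x : is_derive x (delta_mx 0 i) (fun x => phi x * psi x)
    (phi x * partial i psi x + psi x * partial i phi x).
  by apply: is_deriveM; exact: test_function_is_derive.
have [M phi0] := test_function_cube tphi.
have := @integral_partial_eq0 R n (fun x => phi x * psi x) i M.
have -> : partial i (fun x => phi x * psi x) =
    (fun x => phi x * partial i psi x + psi x * partial i phi x).
  by apply/funext => x; case: (d x).
move=> H; rewrite Rintegral_mkcond /Rintegral -[RHS]/(fine 0); congr fine.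
rewrite -[RHS]H; last 3 first.
- by move=> x; case: (d x).
- move=> x; apply: (@continuousD _ _ _ (fun x : E => phi x * partial i psi x)
      (fun x => psi x * partial i phi x)).
    by apply: (@continuousM _ _ phi (partial i psi)); exact: test_function_continuous.
  by apply: (@continuousM _ _ psi (partial i phi)); exact: test_function_continuous.
- by move=> x /phi0 ->; rewrite mul0r.
apply: eq_integral => x _; rewrite patchE; case: ifPn => [_|]; first by rewrite [psi x * _]mulrC.
by rewrite notin_setE => nO; rewrite !(test_function_out _ nO)// !mul0r addr0.
Qed.

(** A bounded set has finite measure, so [|f| <= 1 + f ^ 2] dominates. *)
Lemma L2_integrable_sub f (D : set E) M : L2 Om f -> measurable D ->
  D `<=` Om -> D `<=` cube n M -> mu.-integrable D (EFin \o f).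
Proof.
move=> [mf f2] mD DO DM.
have mfD : measurable_fun D f by apply: measurable_funS mf.
apply: (@le_integrable _ _ _ mu D mD _ ((EFin \o \1_(cube n M)) \+ (fun x => (f x ^+ 2)%:E))%E).
- exact/measurable_EFinP.
- move=> x /DM xM /=; rewrite lee_fin indicE mem_set//.
  rewrite [leRHS]ger0_norm ?addr_ge0 ?sqr_ge0//.
  rewrite -[f x ^+ 2]real_normK ?num_real//=.
  by have := sqr_ge0 (`|f x| - 1); have := normr_ge0 (f x); nra.
- apply: integrableD => //; last by apply: integrableS f2.
  apply: (@integrable_bounded_support _ _ _ mu (cube n M) D 1) => //.
  + exact: cube_measurable.
  + exact: cube_finite.
  + by apply: measurable_indic; exact: cube_measurable.
  + by move=> x; rewrite indicE; case: (_ \in _); rewrite ?normr1 ?normr0.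
  + by move=> x xM; rewrite indicE memNset.
Qed.

End test_functions.

(** * The fundamental lemma of the calculus of variations *)

Section fundamental_lemma.
Context {R : realType} {n : nat}.
Local Notation E := 'rV[R]_n.
Local Notation mu := (lebesgue_rV R n).

(** Orthants are a pi-system generating the measurable sets, and they meet a box
    in a box with the same lower corner. *)
Definition orthant (c : E) : set E := [set x | forall i, x 0 i < c 0 i].

Lemma orthants_setI_closed : setI_closed (range orthant).
Proof.
move=> _ _ [c _ <-] [c' _ <-].
exists (\row_i Num.min (c 0 i) (c' 0 i)) => //.
apply/seteqP; split=> x /=.
  by move=> xc; split => i; have := xc i; rewrite mxE lt_min => /andP[].
by move=> [xc xc'] i; rewrite mxE lt_min (xc i); exact: xc'.
Qed.

Lemma measurable_sub_orthants (A : set E) :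
  measurable A -> <<s range orthant >> A.
Proof.
move=> mA.
suff H i : measurable_fun setT
    (fun x : g_sigma_algebraType (range orthant) => (x : E) 0 i).
  have := @measurable_to_rV R n _ _ (id : g_sigma_algebraType (range orthant) -> E) H.
  by move=> /(_ measurableT _ mA); rewrite setTI.
apply: (measurability _ (RGenInftyO.measurableE R)).
move=> _ [_ [c ->] <-]; rewrite setTI.
rewrite (_ : _ @^-1` _ =
    \bigcup_k orthant (\row_j if j == i then c else k%:R)); last first.
  apply/seteqP; split => x /=; rewrite in_itv/=; last first.
    by move=> [k _ /(_ i)]; rewrite mxE eqxx.
  move=> xc; exists (\max_j Num.bound `|x ord0 j|%R)%N => //= j; rewrite mxE.
  case: eqP => [->//|_]; apply: le_lt_trans (ler_norm _) _.
  apply: (@lt_le_trans _ _ (Num.bound `|x 0 j|)%:R); first exact: archi_boundP.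
  by rewrite ler_nat; apply: (leq_bigmax j).
apply: (@bigcupT_measurable _ (g_sigma_algebraType (range orthant))) => k.
by apply: sub_sigma_algebra; exists (\row_j if j == i then c else k%:R).
Qed.

Lemma open_box_orthant (a b c : E) :
  open_box a b `&` orthant c = open_box a (\row_i Num.min (b 0 i) (c 0 i)).
Proof.
apply/seteqP; split => x /=.
  by move=> [xab xc] i; have /andP[-> xb] := xab i; rewrite mxE lt_min xb; exact: xc.
by move=> H; split => i; have := H i; rewrite mxE lt_min => /and3P[? ? ?]//; exact/andP.
Qed.

Variable Om : set E.
Hypothesis oOm : open Om.
Let mOm : measurable Om := open_rV_measurable oOm.

Variable g : E -> R.
Hypothesis g2 : L2 Om g.
Hypothesis g_test : forall phi, test_function Om phi -> inner Om g phi = 0.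

Lemma open_sub_closed_box a b : open_box a b `<=` (closed_box a b : set E).
Proof. by move=> x ab i; have /andP[/ltW -> /ltW ->] := ab i. Qed.

Lemma box_integrable a b : closed_box a b `<=` Om ->
  mu.-integrable (open_box a b) (EFin \o g).
Proof.
move=> abO; have [M _ abM] := bounded_in_cube (compact_bounded (@closed_box_compact R n a b)).
apply: (@L2_integrable_sub R n Om oOm g _ M) => //.
- exact: open_box_measurable.
- apply: subset_trans abO; exact: open_sub_closed_box.
- apply: subset_trans abM; exact: open_sub_closed_box.
Qed.

(** Dominated convergence along the bump functions, which tend to the indicator
    of the box. *)
Lemma box_integral_eq0 a b : closed_box a b `<=` Om ->
  (\int[mu]_(x in open_box a b) (g x)%:E = 0)%E.
Proof.
move=> abO; set D := open_box a b.
have mD : measurable D by exact: open_box_measurable.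
have DO : D `<=` Om by apply: subset_trans abO; exact: open_sub_closed_box.
have gD := box_integrable abO.
have mg : measurable_fun D g by apply: measurable_funS g2.1.
have mb k : measurable_fun D (bump a b k).
  apply: measurable_funTS; apply: continuous_rV_measurable.
  exact: test_function_continuous (@bump_test_function _ _ Om a b k abO).
have H k : (\int[mu]_(x in D) (g x * bump a b k x)%:E = 0)%E.
  have tb := @bump_test_function _ _ Om a b k abO.
  have gi := L2_mul_integrable mOm g2 (test_function_L2 oOm tb).
  transitivity (\int[mu]_(x in Om) (g x * bump a b k x)%:E)%E.
    rewrite integral_mkcond [RHS]integral_mkcond; apply: eq_integral => x _.
    rewrite !patchE; case: ifPn => xD; first by rewrite mem_set//; apply: DO; exact: set_mem.
    by case: ifP => // _; rewrite bump_eq0 ?mulr0//; move: xD; rewrite notin_setE.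
  rewrite -[LHS]fineK; last exact: (integrable_fin_num mOm gi).
  by congr EFin; exact: g_test tb.
have [||||| _ _] := @dominated_convergence _ _ R mu D mD
  (fun k x => (g x * bump a b k x)%:E) (EFin \o g) (fun x => `|(g x)%:E|%E).
- by move=> k; apply/measurable_EFinP; exact: measurable_funM.
- exact/measurable_EFinP.
- apply: aeW => x Dx; apply: cvg_EFin; first exact: nearW.
  rewrite -[X in _ --> X]mulr1; apply: cvgMr.
  by have := @cvg_bump R n a b x; rewrite indicE mem_set.
- exact: integrable_abse.
- apply: aeW => x k _ /=; rewrite lee_fin normrM ler_piMr//.
  by have /andP[b0 b1] := bump_itv a b k x; rewrite ger0_norm.
under eq_fun do rewrite H.
by move=> /(cvg_unique _ (cvg_cst _)) => <-.
Qed.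

(** By Dynkin's theorem the integral of [g] vanishes over every measurable part
    of the box. *)
Lemma box_ae_eq0 a b : closed_box a b `<=` Om ->
  {ae mu, forall x, open_box a b x -> g x = 0}.
Proof.
move=> abO; set D := open_box a b.
have mD : measurable D by exact: open_box_measurable.
have gD := box_integrable abO.
pose H : set (set E) :=
  [set B | measurable B /\ (\int[mu]_(x in D `&` B) (g x)%:E = 0)%E].
have HG : range orthant `<=` H.
  move=> _ [c _ <-]; split.
    apply: (@measurable_rV_all _ _ (fun i => [set x | x < c 0 i])) => i.
    by rewrite -set_itvNyo; exact: measurable_itv.
  rewrite open_box_orthant box_integral_eq0// => x xac; apply: abO => i.
  by have := xac i; rewrite mxE le_min => /and3P[-> ->].
have dH : dynkin H.
  split.
  - by split => //; rewrite setIT box_integral_eq0.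
  - move=> B [mB B0]; split; first exact: measurableC.
    have : (\int[mu]_(x in D) (g x)%:E = 0)%E by exact: box_integral_eq0.
    have mDB : measurable (D `&` B) by exact: measurableI.
    have mDCB : measurable (D `&` ~` B) by apply: measurableI => //; exact: measurableC.
    rewrite -{1}[D]setIT -(setUv B) setIUr integral_setU//.
    + by rewrite B0 add0e.
    + by rewrite -setIUr setUv setIT; case/integrableP : gD.
    + by apply/disj_setPS; move=> x [[_ xB] [_ /(_ xB)]].
  - move=> F tF HF; split; first by apply: bigcup_measurable => k _; have [] := HF k.
    rewrite setI_bigcupr integral_bigcup//.
    + by apply: eseries0 => k _ _; have [] := HF k.
    + exact: trivIset_setIl.
    + by move=> k; apply: measurableI => //; have [] := HF k.
    + rewrite -setI_bigcupr; apply: integrableS gD => //.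
        by apply: measurableI => //; apply: bigcup_measurable => k _; have [] := HF k.
have allH B : measurable B -> H B.
  move=> /measurable_sub_orthants.
  rewrite -(setI_closed_g_dynkin_g_sigma_algebra orthants_setI_closed).
  by apply: smallest_sub.
have : ae_eq mu D (EFin \o g) (cst 0%E).
  apply: integral_ae_eq => // B BD mB.
  rewrite integral_cst// mul0e; have [_] := allH B mB.
  by rewrite setIidr.
by apply: filterS => x Hx /Hx [].
Qed.

(** Countably many boxes with closure in [Om] cover [Om]. *)
Lemma test_orthogonal_ae_eq0 : {ae mu, forall x, Om x -> g x = 0}.
Proof.
pose P (k : nat) x := forall p : 'rV[rat]_n * rat, unpickle k = Some p ->
  [set y : E | forall i, `|ratr (p.1 0 i) - y 0 i| <= ratr p.2] `<=` Om ->
  ball (map_mx ratr p.1 : E) (ratr p.2 : R) x -> g x = 0.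
have : {ae mu, forall x, forall k, P k x}.
  apply: ae_foralln => k; rewrite /P.
  case: (unpickle k) => [p|]; last by apply: aeW.
  have [pO|pO] := pselect
    ([set y : E | forall i, `|ratr (p.1 0 i) - y 0 i| <= ratr p.2] `<=` Om); last first.
    by apply: aeW => x _ [<-] /pO.
  pose a : E := \row_i (ratr (p.1 0 i) - ratr p.2).
  pose b : E := \row_i (ratr (p.1 0 i) + ratr p.2).
  have abO : closed_box a b `<=` Om.
    move=> x xab; apply: pO => i; have := xab i; rewrite !mxE => xi.
    by rewrite ler_distlC.
  apply: filterS (box_ae_eq0 abO) => x Hx _ [<-] _ [_ px].
  by apply: Hx => i; have := px 0 i; rewrite /ball/= !mxE ltr_distlC.
apply: filterS => x HP; rewrite (open_rV_rational_balls oOm) => -[p pO px].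
by apply: (HP (pickle p) p) => //; rewrite pickleK.
Qed.

End fundamental_lemma.

(** * Weak derivatives and the space H^1_0 *)

Section sobolev_theory.
Context {R : realType} {n : nat} (Om : set 'rV[R]_n).
Hypothesis oOm : open Om.
Local Notation E := 'rV[R]_n.
Local Notation mu := (lebesgue_rV R n).
Implicit Types (f g u v w : E -> R) (s : seq 'I_n).

Let mOm : measurable Om := open_rV_measurable oOm.

Definition weakly_derivable s v :=
  exists g, L2 Om g /\ weak_derivative Om s v g.

Lemma wD_ext s u v : {in Om, u =1 v} -> wD Om s u = wD Om s v.
Proof.
move=> uv; rewrite /wD; congr xget; apply/funext => g; apply/propext.
rewrite /weak_derivative /=; split=> -[g2 H]; split=> // phi tphi.
  by rewrite -H//; apply: inner_eq => // x Ox; rewrite uv.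
by rewrite -H//; apply: inner_eq => // x Ox; rewrite uv.
Qed.

Lemma wD_L2 s v : weakly_derivable s v -> L2 Om (wD Om s v).
Proof. by move=> dv; have [] := xgetPex (fun=> 0) dv. Qed.

Lemma wD_weak s v : weakly_derivable s v -> weak_derivative Om s v (wD Om s v).
Proof. by move=> dv; have [] := xgetPex (fun=> 0) dv. Qed.

(** The difference of two weak derivatives is orthogonal to all test functions. *)
Lemma weak_derivative_unique s v g h : L2 Om g -> L2 Om h ->
  weak_derivative Om s v g -> weak_derivative Om s v h ->
  {ae mu, forall x, Om x -> g x = h x}.
Proof.
move=> g2 h2 vg vh.
have : {ae mu, forall x, Om x -> -1 * h x + g x = 0}.
  apply: (test_orthogonal_ae_eq0 oOm (L2_linear mOm (-1) h2 g2)) => phi tphi.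
  rewrite inner_linear//; last exact: test_function_L2.
  have sgn : (-1) ^+ size s != 0 :> R by rewrite signr_eq0.
  apply: (mulfI sgn); rewrite mulr0 mulrDr mulrCA -vg// -vh//.
  by rewrite mulN1r addNr.
by apply: filterS => x H /H /eqP; rewrite mulN1r addrC subr_eq0 => /eqP.
Qed.

Lemma weak_derivative_linear s a u v g h :
  L2 Om u -> L2 Om v -> L2 Om g -> L2 Om h ->
  weak_derivative Om s u g -> weak_derivative Om s v h ->
  weak_derivative Om s (fun x => a * u x + v x) (fun x => a * g x + h x).
Proof.
move=> u2 v2 g2 h2 ug vh phi tphi.
have t2 := test_function_L2 oOm tphi.
have t2' := test_function_L2 oOm (test_function_partials s tphi).
rewrite !inner_linear// ug// vh//; ring.
Qed.

Lemma weakly_derivable_linear s a u v : L2 Om u -> L2 Om v ->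
  weakly_derivable s u -> weakly_derivable s v ->
  weakly_derivable s (fun x => a * u x + v x).
Proof.
move=> u2 v2 [g [g2 ug]] [h [h2 vh]].
exists (fun x => a * g x + h x); split; first exact: L2_linear.
exact: weak_derivative_linear.
Qed.

(** Only almost everywhere: both sides are weak derivatives of the same function,
    but [wD] picks representatives. *)
Lemma wD_linear s a u v : L2 Om u -> L2 Om v ->
  weakly_derivable s u -> weakly_derivable s v ->
  {ae mu, forall x, Om x ->
    wD Om s (fun x => a * u x + v x) x = a * wD Om s u x + wD Om s v x}.
Proof.
move=> u2 v2 du dv; have dw := weakly_derivable_linear a u2 v2 du dv.
have [ud vd] := (wD_L2 du, wD_L2 dv).
apply: weak_derivative_unique (wD_L2 dw) (L2_linear mOm a ud vd) (wD_weak dw) _.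
by apply: weak_derivative_linear => //; exact: wD_weak.
Qed.

Lemma sobolevH_derivable m s v : sobolevH Om m v -> (size s <= m)%N ->
  weakly_derivable s v.
Proof. by move=> [_ H] /H. Qed.

Lemma sobolevH_linear m a u v : sobolevH Om m u -> sobolevH Om m v ->
  sobolevH Om m (fun x => a * u x + v x).
Proof.
move=> [u2 du] [v2 dv]; split; first exact: L2_linear.
move=> s sm; apply: weakly_derivable_linear => //; [exact: du|exact: dv].
Qed.

Lemma sobolevH0 m : sobolevH Om m (fun=> 0).
Proof.
split; first exact: L2_cst0.
move=> s _; exists (fun=> 0); split; first exact: L2_cst0.
by move=> phi _; rewrite !inner0l mulr0.
Qed.

(** Needed to compare [v - phi] with [v] in H^1: were [phi] without weak
    derivatives, [wD] would be a junk value. *)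
Lemma test_function_sobolevH1 phi : test_function Om phi -> sobolevH Om 1 phi.
Proof.
move=> tphi; split; first exact: test_function_L2.
case=> [_|i [|//] _].
  exists phi; split; first exact: test_function_L2.
  by move=> psi _; rewrite mul1r.
exists (partial i phi); split.
  by apply: test_function_L2 => //; exact: test_function_partial.
by move=> psi tpsi /=; rewrite mulN1r test_function_by_parts.
Qed.

Lemma normL2_wD_linear_le s a u v : L2 Om u -> L2 Om v ->
  weakly_derivable s u -> weakly_derivable s v ->
  normL2 Om (wD Om s (fun x => a * u x + v x)) ^+ 2 <=
  2 * a ^+ 2 * normL2 Om (wD Om s u) ^+ 2 + 2 * normL2 Om (wD Om s v) ^+ 2.
Proof.
move=> u2 v2 du dv; have dw := weakly_derivable_linear a u2 v2 du dv.
have lin2 := L2_linear mOm a (wD_L2 du) (wD_L2 dv).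
have e := wD_linear a u2 v2 du dv.
apply: le_trans (normL2_linear_le mOm a (wD_L2 du) (wD_L2 dv)).
rewrite !normL2_sqr (ae_eq_inner mOm (wD_L2 dw) lin2 (wD_L2 dw) e).
by rewrite innerC (ae_eq_inner mOm (wD_L2 dw) lin2 lin2 e).
Qed.

Lemma normH1_sqr v : normH1 Om v ^+ 2 =
  normL2 Om v ^+ 2 + \sum_i normL2 Om (wD Om [:: i] v) ^+ 2.
Proof.
by rewrite sqr_sqrtr// addr_ge0 ?sqr_ge0// sumr_ge0// => i _; exact: sqr_ge0.
Qed.

Lemma normH1_linear_le a u v : sobolevH Om 1 u -> sobolevH Om 1 v ->
  normH1 Om (fun x => a * u x + v x) ^+ 2 <=
  2 * a ^+ 2 * normH1 Om u ^+ 2 + 2 * normH1 Om v ^+ 2.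
Proof.
move=> [u2 du] [v2 dv].
move: (normH1 Om) normH1_sqr => N NE; rewrite !NE.
rewrite [in leRHS]mulrDr [X in _ <= _ + X]mulrDr addrACA.
apply: lerD; first exact: (normL2_linear_le mOm a u2 v2).
rewrite !mulr_sumr -big_split/=; apply: ler_sum => i _.
by apply: normL2_wD_linear_le => //; [exact: du|exact: dv].
Qed.

Lemma H10_linear a u v : H10 Om u -> H10 Om v -> H10 Om (fun x => a * u x + v x).
Proof.
move=> [su au] [sv av]; split; first exact: sobolevH_linear.
move=> e e0; have a1 : 0 < `|a| + 1 by rewrite ltr_wpDl.
(* Approximating [u] and [v] within [d] leaves a squared error of at most
   [2 (a ^ 2 + 1) d ^ 2 <= e ^ 2 / 2]. *)
pose d := e / (2 * (`|a| + 1)); have d0 : 0 < d by rewrite divr_gt0// mulr_gt0.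
have [phi tphi uphi] := au d d0; have [psi tpsi vpsi] := av d d0.
exists (fun x => a * phi x + psi x); first exact: test_function_linear.
have sub w chi : sobolevH Om 1 w -> test_function Om chi ->
    sobolevH Om 1 (fun x => w x - chi x).
  move=> sw tchi; rewrite (_ : (fun _ => _) = (fun x => -1 * chi x + w x)).
    by apply: sobolevH_linear => //; exact: test_function_sobolevH1.
  by apply/funext => x; rewrite mulN1r addrC.
rewrite (_ : (fun _ => _) = (fun x => a * (u x - phi x) + (v x - psi x))); last first.
  by apply/funext => x; ring.
rewrite -(@ltr_pXn2r _ 2)// ?nnegrE ?sqrtr_ge0 ?ltW//.
apply: le_lt_trans (normH1_linear_le a (sub _ _ su tphi) (sub _ _ sv tpsi)) _.
have sqr_le w : normH1 Om w < d -> normH1 Om w ^+ 2 <= d ^+ 2.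
  by move=> wd; rewrite lerXn2r ?nnegrE ?sqrtr_ge0 ?ltW.
apply: (@le_lt_trans _ _ (2 * a ^+ 2 * d ^+ 2 + 2 * d ^+ 2)).
  apply: lerD; apply: ler_wpM2l => //; [|exact: sqr_le uphi|exact: sqr_le vpsi].
  by rewrite mulr_ge0// sqr_ge0.
have -> : e = d * (2 * (`|a| + 1)) by rewrite divfK// mulf_neq0// gt_eqF.
clearbody d.
rewrite exprMn -[a ^+ 2]real_normK ?num_real//.
set b := `|a|; have b0 : 0 <= b by exact: normr_ge0.
rewrite -subr_gt0 (_ : _ - _ = d ^+ 2 * (2 * b ^+ 2 + 8 * b + 2)); last by ring.
by rewrite mulr_gt0 ?exprn_gt0// ltr_wpDl// addr_ge0 ?mulr_ge0 ?sqr_ge0.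
Qed.

Lemma H100 : H10 Om (fun=> 0).
Proof.
split; first exact: sobolevH0.
move=> e e0; exists (fun=> 0); first exact: test_function0.
under eq_fun do rewrite subr0.
suff -> : normH1 Om (fun=> 0) = 0 by [].
apply/eqP; rewrite -sqrf_eq0 normH1_sqr normL2_sqr inner0l add0r.
rewrite big1// => i _; rewrite normL2_sqr.
have d0 := sobolevH_derivable (sobolevH0 1) (isT : (size [:: i] <= 1)%N).
rewrite (@ae_eq_inner _ _ _ mOm _ (fun=> 0)) ?inner0l//;
  [exact: wD_L2|exact: L2_cst0|exact: wD_L2|].
apply: weak_derivative_unique (wD_L2 d0) (L2_cst0 Om) (wD_weak d0) _.
by move=> phi _; rewrite !inner0l mulr0.
Qed.

End sobolev_theory.

(** * The bilinear form and the H^2 inner product *)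

Section L2_operators.
Context {R : realType} {n : nat} (Om : set 'rV[R]_n).
Hypothesis oOm : open Om.
Local Notation E := 'rV[R]_n.
Local Notation mu := (lebesgue_rV R n).
Implicit Types (f g u v w : E -> R) (s : seq 'I_n) (V : set (E -> R)).

Let mOm : measurable Om := open_rV_measurable oOm.

(** The differential operators at hand are built from chosen weak derivatives, so
    they are linear almost everywhere rather than pointwise.  This suffices for
    the forms [inner Om (T u) g] to be linear, and it is preserved by sums and by
    bounded measurable coefficients. *)
Record L2_operator V (T : (E -> R) -> E -> R) : Prop := {
  L2_operator_L2 : forall u, V u -> L2 Om (T u) ;
  L2_operator_linear : forall a u v, V u -> V v ->
    {ae mu, forall x, Om x -> T (fun y => a * u y + v y) x = a * T u x + T v x} ;
  L2_operator_ext : forall u v, {in Om, u =1 v} -> {in Om, T u =1 T v} }.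

Lemma L2_operator_id V : V `<=` L2 Om -> L2_operator V id.
Proof. by move=> V2; split => // a u v Vu Vv; exact: aeW. Qed.

Lemma L2_operator_wD V m s : V `<=` sobolevH Om m -> (size s <= m)%N ->
  L2_operator V (wD Om s).
Proof.
move=> VH sm; split => [u /VH[u2 du]|a u v /VH[u2 du] /VH[v2 dv]|u v uv].
- by apply: wD_L2; exact: du.
- by apply: wD_linear => //; [exact: du|exact: dv].
- by move=> x _; rewrite (wD_ext s uv).
Qed.

Lemma L2_operator_mul V T (c : E -> R) (M : R) : measurable_fun Om c ->
  (forall x, Om x -> `|c x| <= M) -> L2_operator V T ->
  L2_operator V (fun v x => c x * T v x).
Proof.
move=> mc cM [T2 Tl Te]; split => [u Vu|a u v Vu Vv|u v uv x Ox].
- by apply: L2_bounded_mul (T2 u Vu) mc cM.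
- by apply: filterS (Tl a u v Vu Vv) => x H Ox; rewrite H//; ring.
- by rewrite (Te u v uv).
Qed.

Lemma L2_operator_sum V (I : finType) (T : I -> (E -> R) -> E -> R) :
  (forall i, L2_operator V (T i)) ->
  L2_operator V (fun v x => \sum_i T i v x).
Proof.
move=> HT; split => [u Vu|a u v Vu Vv|u v uv x Ox].
- elim: (index_enum I) => [|i r IH].
    by under eq_fun do rewrite big_nil; exact: L2_cst0.
  under eq_fun do rewrite big_cons -[X in X + _]mul1r.
  exact: (L2_linear mOm 1 (L2_operator_L2 (HT i) Vu) IH).
- have : {ae mu, forall x, forall i, Om x ->
      T i (fun y => a * u y + v y) x = a * T i u x + T i v x}.
    by apply: filter_forall => i; exact: (L2_operator_linear (HT i)).
  apply: filterS => x H Ox; rewrite mulr_sumr -big_split/=.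
  by apply: eq_bigr => i _; exact: H.
- by apply: eq_bigr => i _; exact: (L2_operator_ext (HT i) uv).
Qed.

Lemma L2_operator_inner_linear V T (D : set E) g : lincomb_closed V ->
  L2_operator V T -> L2 Om g -> Om `<=` D ->
  linear_on D V (fun u => inner Om (T u) g).
Proof.
move=> VL HT g2 OD; split => [a u v Vu Vv|u v uv].
  have Tu := L2_operator_L2 HT Vu; have Tv := L2_operator_L2 HT Vv.
  rewrite -inner_linear//; apply: ae_eq_inner => //.
  - by apply: (L2_operator_L2 HT); exact: VL.2.
  - exact: L2_linear.
  - exact: (L2_operator_linear HT).
by apply: inner_eq => //; apply: (L2_operator_ext HT) => x /set_mem Ox; exact/uv/OD.
Qed.

End L2_operators.

Lemma linear_on_comb (X : Type) (F : fieldType) (D : set X) (V : set (X -> F))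
    (b c : F) (l l' : (X -> F) -> F) :
  linear_on D V l -> linear_on D V l' ->
  linear_on D V (fun u => b * l u + c * l' u).
Proof.
move=> [ll le] [ll' le']; split => [a u v Vu Vv|u v uv].
  by rewrite ll// ll'//; ring.
by rewrite (le u v uv) (le' u v uv).
Qed.

Lemma linear_on_sum_fun (X : Type) (F : fieldType) (D : set X)
    (V : set (X -> F)) (I : finType) (l : I -> (X -> F) -> F) :
  (forall i, linear_on D V (l i)) -> linear_on D V (fun u => \sum_i l i u).
Proof.
move=> ll; split => [a u v Vu Vv|u v uv].
  by rewrite mulr_sumr -big_split/=; apply: eq_bigr => i _; exact: (ll i).1.
by apply: eq_bigr => i _; exact: (ll i).2.
Qed.

Section H2_forms.
Context {R : realType} {n : nat} (Om : set 'rV[R]_n).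
Hypothesis dOm : domain Om.
Local Notation E := 'rV[R]_n.
Variable A : E -> 'M[R]_n.
Hypothesis cA : forall i j, {within closure Om, continuous (fun x => A x i j)}.
Variable V : set (E -> R).
Hypothesis VL : lincomb_closed V.
Hypothesis VH2 : V `<=` sobolevH Om 2.

Let oOm : open Om. Proof. by case: dOm. Qed.
Let mOm : measurable Om := open_rV_measurable oOm.

Lemma within_closure_continuous (f : E -> R) x :
  {within closure Om, continuous f} -> Om x -> {for x, continuous f}.
Proof.
move=> cf Ox; have : {within Om, continuous f}.
  by apply: continuous_subspaceW cf; exact: subset_closure.
by rewrite continuous_open_subspace//; apply; exact/mem_set.
Qed.

(** Bounds the continuous coefficients of [A] by compactness. *)
Lemma closure_domain_compact : compact (closure Om).
Proof.
have [_ _ _ bO] := dOm; have [M _ OM] := bounded_in_cube bO.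
apply: (subclosed_compact _ (@cube_compact R n M)); first exact: closed_closure.
by rewrite closureE; apply: smallest_sub => //; exact: closed_cube.
Qed.

Lemma within_closure_bounded (f : E -> R) :
  {within closure Om, continuous f} -> exists M, forall x, Om x -> `|f x| <= M.
Proof.
move=> cf; have := continuous_compact cf closure_domain_compact.
move=> /compact_bounded[M [_ KM]]; exists (`|M| + 1) => x Ox.
apply: (KM (`|M| + 1)); first by rewrite (le_lt_trans (ler_norm _))// ltrDl.
by exists x => //; exact: subset_closure.
Qed.

Lemma L2_operator_laplacian : L2_operator Om V (laplacian Om).
Proof.
apply: (@L2_operator_sum _ _ _ oOm V _ (fun i => wD Om [:: i; i])) => i.
exact: L2_operator_wD VH2 _.
Qed.

Lemma L2_operator_AD2 : L2_operator Om V (AD2 Om A).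
Proof.
apply: (@L2_operator_sum _ _ _ oOm V _
  (fun i v x => \sum_j A x i j * wD Om [:: i; j] v x)) => i.
apply: (@L2_operator_sum _ _ _ oOm V _
  (fun j v x => A x i j * wD Om [:: i; j] v x)) => j.
have [M AM] := within_closure_bounded (@cA i j).
apply: (@L2_operator_mul _ _ _ oOm V _ (fun x => A x i j) M) => //.
  by apply: continuous_at_measurable => // x Ox; exact: within_closure_continuous.
exact: L2_operator_wD VH2 _.
Qed.

Lemma L2_operator_V_id : L2_operator Om V id.
Proof. by apply: L2_operator_id => v /VH2[]. Qed.

Lemma Bform_linear_l eps v : V v -> linear_on (closure Om) V (Bform Om A eps ^~ v).
Proof.
move=> Vv; rewrite /Bform.
have lap := L2_operator_inner_linear oOm VL L2_operator_laplacian
  (L2_operator_L2 L2_operator_laplacian Vv) (@subset_closure _ Om).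
have AD := L2_operator_inner_linear oOm VL L2_operator_AD2
  (L2_operator_L2 L2_operator_V_id Vv) (@subset_closure _ Om).
have := linear_on_comb eps (-1) lap AD.
by under eq_fun do rewrite mulN1r.
Qed.

Lemma Bform_linear_r eps u : V u -> linear_on (closure Om) V (Bform Om A eps u).
Proof.
move=> Vu.
have lap := L2_operator_inner_linear oOm VL L2_operator_laplacian
  (L2_operator_L2 L2_operator_laplacian Vu) (@subset_closure _ Om).
have I := L2_operator_inner_linear oOm VL L2_operator_V_id
  (L2_operator_L2 L2_operator_AD2 Vu) (@subset_closure _ Om).
have := linear_on_comb eps (-1) lap I; congr linear_on.
by apply/funext => v; rewrite mulN1r innerC [inner Om (id v) _]innerC.
Qed.

(** Presents the norm [normH2] as the l^2 norm of one finite family of L^2 norms,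
    to which [inner_sum_CauchySchwarz] applies. *)
Definition H2_index : finType := (unit + 'I_n + 'I_n * 'I_n)%type.

Definition H2_component (j : H2_index) (v : E -> R) : E -> R :=
  match j with
  | inl (inl _) => v
  | inl (inr i) => wD Om [:: i] v
  | inr ij => wD Om [:: ij.1; ij.2] v
  end.

Definition innerH2 (u v : E -> R) : R :=
  \sum_j inner Om (H2_component j u) (H2_component j v).

Lemma L2_operator_H2_component j : L2_operator Om V (H2_component j).
Proof.
case: j => [[[]|i]|[i j]] /=; first exact: L2_operator_V_id.
  exact: L2_operator_wD VH2 _.
exact: L2_operator_wD VH2 _.
Qed.

Lemma innerH2C u v : innerH2 u v = innerH2 v u.
Proof. by apply: eq_bigr => j _; exact: innerC. Qed.

Lemma normH2_sqr v : normH2 Om v ^+ 2 = innerH2 v v.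
Proof.
rewrite /normH2 sqr_sqrtr; last first.
  by rewrite !addr_ge0 ?sqr_ge0// sumr_ge0// => i _; rewrite ?sumr_ge0// => *; exact: sqr_ge0.
rewrite /innerH2 !big_sumType/= big_const card_unit/= addr0 normL2_sqr; congr (_ + _ + _).
  by apply: eq_bigr => i _; rewrite normL2_sqr.
by rewrite pair_bigA/=; apply: eq_bigr => i _; rewrite normL2_sqr.
Qed.

Lemma innerH2_linear u : V u -> linear_on (closure Om) V (innerH2 u).
Proof.
move=> Vu; rewrite (_ : innerH2 u =
  fun v => \sum_j inner Om (H2_component j v) (H2_component j u)).
  apply: linear_on_sum_fun => j; have HT := L2_operator_H2_component j.
  apply: (L2_operator_inner_linear oOm VL HT (L2_operator_L2 HT Vu)).
  exact: subset_closure.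
by apply/funext => v; rewrite innerH2C.
Qed.

Lemma innerH2_CauchySchwarz u v : V u -> V v ->
  innerH2 u v <= normH2 Om u * normH2 Om v.
Proof.
move=> Vu Vv; have L2c w j (Vw : V w) := L2_operator_L2 (L2_operator_H2_component j) Vw.
have := inner_sum_CauchySchwarz mOm (L2c u ^~ Vu) (L2c v ^~ Vv).
have sumE w : \sum_j normL2 Om (H2_component j w) ^+ 2 = normH2 Om w ^+ 2.
  by rewrite normH2_sqr; apply: eq_bigr => j _; exact: normL2_sqr.
rewrite (f_equal2 *%R (sumE u) (sumE v)) -/(innerH2 u v).
have Nu : 0 <= normH2 Om u by exact: sqrtr_ge0.
have Nv : 0 <= normH2 Om v by exact: sqrtr_ge0.
move: (normH2 Om u) (normH2 Om v) Nu Nv => a b a0 b0; rewrite -exprMn => H.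
apply: le_trans (ler_norm _) _.
by rewrite -(@ler_pXn2r _ 2)// ?nnegrE ?mulr_ge0// real_normK ?num_real.
Qed.

End H2_forms.

(** * The finite element space *)

Section finite_elements.
Context {R : realType} {n : nat} (Om : set 'rV[R]_n).
Hypothesis dOm : domain Om.
Local Notation E := 'rV[R]_n.
Local Notation mu := (lebesgue_rV R n).
Variables (k : nat) (Th : set (set E)).
Hypothesis meshTh : mesh Om Th.

Let oOm : open Om. Proof. by case: dOm. Qed.
Let mOm : measurable Om := open_rV_measurable oOm.
Local Notation Vh := (fe_space Om k Th).

Lemma within_continuous_linear (D : set E) a (u v : E -> R) :
  {within D, continuous u} -> {within D, continuous v} ->
  {within D, continuous (fun x => a * u x + v x)}.
Proof.
move=> cu cv x.
apply: (@continuousD _ _ (subspace D) (fun x => a * u x) v); last exact: cv.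
apply: (@continuousM _ (subspace D) (fun=> a) u); last exact: cu.
exact: cst_continuous.
Qed.

Lemma C1_closure_linear a u v :
  C1_closure Om u -> C1_closure Om v -> C1_closure Om (fun x => a * u x + v x).
Proof.
move=> [cu du] [cv dv]; split; first exact: within_continuous_linear.
move=> i; have [g [cg dg]] := du i; have [h [ch dh]] := dv i.
exists (fun x => a * g x + h x); split; first exact: within_continuous_linear.
move=> x Ox; have [ux <-] := dg x Ox; have [vx <-] := dh x Ox.
have : is_derive x (delta_mx 0 i) (fun x => a * u x + v x)
    (a * partial i u x + partial i v x).
  apply: is_deriveD; last exact: partial_is_derive.
  by apply: is_deriveZ; exact: partial_is_derive.
by case.
Qed.

Lemma C1_closure0 : C1_closure Om (fun=> 0 : R).
Proof.
have c0 : {within closure Om, continuous (fun=> 0 : R)}.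
  by apply: continuous_subspaceT => x; exact: cst_continuous.
split => // i; exists (fun=> 0); split => // x _; split; first exact: derivable_cst.
exact: derive_cst.
Qed.

Lemma poly_on_linear (T : set E) a u v :
  poly_on k T u -> poly_on k T v -> poly_on k T (fun x => a * u x + v x).
Proof.
move=> [c uE] [d vE]; exists (fun i => a * c i + d i) => x Tx.
rewrite uE// vE// mulr_sumr -big_split/=; apply: eq_bigr => i _.
by rewrite mulrDl mulrA.
Qed.

Lemma fe_space_lincomb_closed : lincomb_closed Vh.
Proof.
split=> [|a u v [cu hu pu] [cv hv pv]].
  split; [exact: C1_closure0|exact: H100|].
  move=> T _; exists (fun=> 0) => x _; rewrite big1// => i _; exact: mul0r.
split; [exact: C1_closure_linear|exact: H10_linear|].
by move=> T ThT; apply: poly_on_linear; [exact: pu|exact: pv].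
Qed.

Lemma finite_set_codom (U : Type) (S : set U) : finite_set S ->
  exists (N : nat) (c : 'I_N -> U),
    (forall i, S (c i)) /\ forall T, S T -> exists i, c i = T.
Proof.
move=> [N /card_set_bijP[f [fS finj fsurj]]]; exists N.
have /choice[c cS] : forall i : 'I_N, exists T, S T /\ f T = i.
  by move=> i; have [T ST fT] := fsurj i (ltn_ord i); exists T.
exists c; split => [i|T ST]; first by have [] := cS i.
have fT := fS _ ST; have [Sc fc] := cS (Ordinal fT).
by exists (Ordinal fT); apply: finj; rewrite ?inE.
Qed.

(** Cells overlap on their faces, so each point is assigned to a single cell that
    contains it; the monomials restricted to the points of a given cell then span
    the space on the closure of the domain. *)
Lemma fe_space_finite_span : exists (J : finType) (e : J -> E -> R),
  forall v, Vh v -> exists c : J -> R,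
    forall x, closure Om x -> v x = \sum_j c j * e j x.
Proof.
have [finTh _ covTh _] := meshTh.
have [N [cell [Thcell cellTh]]] := finite_set_codom finTh.
pose sel x : option 'I_N := [pick i | `[< cell i x >]].
pose J : finType := ('I_N * {ffun 'I_n -> 'I_k.+1})%type.
exists J, (fun (j : J) x => if sel x == Some j.1 then \prod_i x 0 i ^+ j.2 i else 0).
move=> v [_ _ pv].
have /choice[c cE] : forall i, exists c : {ffun 'I_n -> 'I_k.+1} -> R,
    forall x, cell i x ->
    v x = \sum_(a : {ffun 'I_n -> 'I_k.+1} | (\sum_i a i <= k)%N)
            c a * \prod_i x 0 i ^+ a i.
  by move=> i; exact: pv.
exists (fun j : J => if (\sum_i j.2 i <= k)%N then c j.1 j.2 else 0) => x Ox.
rewrite -(pair_bigA _ (fun i (a : {ffun 'I_n -> 'I_k.+1}) =>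
   (if (\sum_i a i <= k)%N then c i a else 0) *
   (if sel x == Some i then \prod_i x 0 i ^+ a i else 0)))/=.
rewrite /sel; case: pickP => [i /asboolP xi|nox]; last first.
  move: Ox; rewrite -covTh => -[T /cellTh[i <-] xi].
  by have /asboolP := nox i.
rewrite (bigD1 i)//= [X in _ + X]big1 => [|j ji].
  rewrite addr0 (cE i x xi) big_mkcond/=; apply: eq_bigr => a _.
  by rewrite eqxx; case: ifP => // _; rewrite mul0r.
rewrite big1// => a _; rewrite [X in _ * X]ifF ?mulr0//; apply/negbTE.
by apply: contra ji => /eqP[->].
Qed.

Let nbhs_neq0 (r : R) : r != 0 -> nbhs r [set t | t != 0].
Proof. by move=> r0; apply: open_nbhs_nbhs; split => //; exact: open_neq. Qed.

(** A continuous function that is nonzero somewhere in [Om] is so on a nonempty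
    open set, which has positive measure; density takes care of the boundary. *)
Lemma continuous_ae_eq0 (v : E -> R) : {within closure Om, continuous v} ->
  {ae mu, forall x, Om x -> v x = 0} -> forall x, closure Om x -> v x = 0.
Proof.
move=> cv v0.
have vOm x : Om x -> v x = 0.
  move=> Ox; apply: contrapT => vx.
  pose U := Om `&` [set y | v y != 0].
  have oU : open U.
    rewrite openE => y [Oy vy]; apply: filterI; first exact: open_nbhs_nbhs.
    exact: (within_closure_continuous dOm cv Oy (nbhs_neq0 vy)).
  have : (0 < mu U)%E by apply: open_rV_positive oU _; exists x; split => //; exact/eqP.
  case: v0 => B [mB B0 vB]; apply/negP; rewrite -leNgt -B0.
  apply: le_measure; rewrite ?inE//; first exact: open_rV_measurable.
  by move=> y [Oy /eqP vy]; apply: vB => /(_ Oy).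
move=> x cx; apply: contrapT => /eqP vx.
have /subspace_continuousP/(_ x cx) := cv.
move=> /(_ _ (nbhs_neq0 vx))/nbhs_ballP[e /= e0 H].
have [y [Oy xy]] := cx _ (nbhsx_ballx x e e0).
have /eqP := H y xy (subset_closure Oy); apply; exact: vOm.
Qed.

Lemma fe_space_normL2_eq0 v : Vh v -> normL2 Om v = 0 ->
  forall x, closure Om x -> v x = 0.
Proof.
move=> [[cv _] [[v2 _] _] _] v0; apply: continuous_ae_eq0 => //.
by apply: inner0_ae => //; rewrite -normL2_sqr v0 expr0n.
Qed.

End finite_elements.

(** * Stability of the discrete problem *)

Section discrete_stability.
Context {R : realType} {n : nat} (Om : set 'rV[R]_n).
Local Notation E := 'rV[R]_n.
Variable A : E -> 'M[R]_n.

(** The adjoint is defined by choice among the functions that represent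
    [Bform Om A eps ^~ v] on [V]; were there none it would be [0], for which the
    bound holds as well. *)
Lemma normHm2_adjoint_le (V : set (E -> R)) eps v K : 0 <= K ->
  (forall w, V w -> Bform Om A eps w v <= K * normH2 Om w) ->
  normHm2 Om V (Lh_adjoint Om A V eps v) <= K.
Proof.
move=> K0 BK; set g := Lh_adjoint _ _ _ _ _.
have gK w : V w -> inner Om g w <= K * normH2 Om w.
  rewrite /g /Lh_adjoint => Vw; case: xgetP => [g' _ [_ gB]|_].
    by rewrite gB//; exact: BK.
  by rewrite inner0l mulr_ge0// sqrtr_ge0.
rewrite /normHm2; set S := (X in sup X).
have [->|/set0P S0] := eqVneq S set0; first by rewrite sup0.
apply: ge_sup => // _ [w [Vw _] <-].
have := gK w Vw; have : 0 <= normH2 Om w by exact: sqrtr_ge0.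
move: (normH2 Om w) => N N0 gN; have [->|Nn0] := eqVneq N 0.
  by rewrite invr0 mulr0.
by rewrite ler_pdivrMr// lt0r Nn0.
Qed.

(** The duality argument, for any space of H^2 functions that is finite
    dimensional on the closure of the domain. *)
Lemma discrete_solution_stable (V : set (E -> R)) (J : finType) (e : J -> E -> R)
    (C eps : R) (f : E -> R) :
  domain Om ->
  (forall i j, {within closure Om, continuous (fun x => A x i j)}) ->
  lincomb_closed V -> V `<=` sobolevH Om 2 ->
  (forall v, V v -> exists c : J -> R,
     forall x, closure Om x -> v x = \sum_j c j * e j x) ->
  (forall v, V v -> normL2 Om v = 0 -> forall x, closure Om x -> v x = 0) ->
  0 < C ->
  (forall v, V v -> normL2 Om v <= C * normHm2 Om V (Lh_adjoint Om A V eps v)) ->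
  L2 Om f ->
  exists u, [/\ discrete_solution Om A V eps f u,
    forall u', discrete_solution Om A V eps f u' ->
      forall x, closure Om x -> u' x = u x
    & normH2 Om u <= C * normL2 Om f].
Proof.
move=> dOm cA VL VH2 Vspan Vdef C0 adj f2.
have oOm : open Om by case: dOm.
have mOm := open_rV_measurable oOm.
have Bl v := @Bform_linear_l R n Om dOm A cA V VL VH2 eps v.
have Br u := @Bform_linear_r R n Om dOm A cA V VL VH2 eps u.
have Binj v : V v -> (forall w, V w -> Bform Om A eps w v = 0) ->
    forall x, closure Om x -> v x = 0.
  move=> Vv Bv0; apply: Vdef => //; apply/eqP; rewrite eq_le sqrtr_ge0 andbT.
  apply: le_trans (adj v Vv) _; rewrite pmulr_rle0//.
  by apply: normHm2_adjoint_le => // w Vw; rewrite Bv0// mul0r.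
have [solve dual_solve inj] := bilinear_solve VL Vspan Bl Br Binj.
have Vf : linear_on (closure Om) V (inner Om f).
  have := L2_operator_inner_linear oOm VL (L2_operator_V_id VH2) f2 (@subset_closure _ Om).
  by congr linear_on; apply/funext => v; rewrite innerC.
have [u Vu uf] := solve _ Vf.
exists u; split => //.
- move=> u' [Vu' u'f] x cx.
  have Vd : V (fun x => -1 * u x + u' x) by exact: VL.2.
  have /eqP : -1 * u x + u' x = 0.
    apply: inj Vd _ x cx => v Vv.
    by rewrite ((Bl v Vv).1 (-1) u u')// uf// u'f// mulN1r addNr.
  by rewrite mulN1r addrC subr_eq0 => /eqP.
- have [v Vv vu] := dual_solve _ (innerH2_linear dOm VL VH2 Vu).
  have vC : normL2 Om v <= C * normH2 Om u.
    apply: le_trans (adj v Vv) _; rewrite ler_pM2l//.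
    apply: normHm2_adjoint_le; first exact: sqrtr_ge0.
    by move=> w Vw; rewrite vu//; exact: (innerH2_CauchySchwarz dOm VH2).
  have uu : normH2 Om u ^+ 2 <= normL2 Om f * normL2 Om v.
    rewrite normH2_sqr -vu// uf//; apply: inner_CauchySchwarz => //.
    by have [] := VH2 _ Vv.
  have Nu : 0 <= normH2 Om u by exact: sqrtr_ge0.
  have Nf : 0 <= normL2 Om f by exact: sqrtr_ge0.
  move: (normH2 Om u) (normL2 Om f) (normL2 Om v) Nu Nf vC uu => a b c a0 b0 ca aa.
  have [->|an0] := eqVneq a 0; first by rewrite mulr_ge0// ltW.
  have ap : 0 < a by rewrite lt0r an0.
  rewrite -(ler_pM2r ap) -expr2 (le_trans aa)// [C * b]mulrC -mulrA.
  by rewrite ler_wpM2l.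
Qed.

End discrete_stability.

Unset Implicit Arguments.

Theorem theorem4p8 (R : realType) (n : nat) (hn : (0 < n)%N)
    (Om : set 'rV[R]_n) (hOm : domain Om)
    (A : 'rV[R]_n -> 'M[R]_n)
    (hAcont : forall i j, {within closure Om, continuous (fun x => A x i j)})
    (hAell : uniformly_elliptic Om A)
    (hwp : well_posed Om A)
    (Hs : set R) (Th : R -> set (set 'rV[R]_n))
    (hTh : mesh_family Om Hs Th)
    (hshape : shape_regular Hs Th) (hquasi : quasi_uniform Hs Th)
    (k : nat)
    (hconf : forall h, Hs h -> fe_space Om k (Th h) `<=` H2H10 Om)
    (C0 beta : R) (hC0 : 0 < C0) (hbeta : 2 <= beta)
    (h0 : R) (hh0 : 0 < h0)
    (hadj : exists2 C : R, 0 < C &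
      forall h eps : R, Hs h -> h < h0 -> 0 < eps <= C0 * h `^ beta ->
      forall v, fe_space Om k (Th h) v ->
        normL2 Om v <=
          C * normHm2 Om (fe_space Om k (Th h))
                (Lh_adjoint Om A (fe_space Om k (Th h)) eps v)) :
  exists2 C : R, 0 < C &
    forall h eps : R, Hs h -> h < h0 -> 0 < eps <= C0 * h `^ beta ->
    forall f : 'rV[R]_n -> R, L2 Om f ->
      exists u : 'rV[R]_n -> R,
        [/\ discrete_solution Om A (fe_space Om k (Th h)) eps f u,
            forall u', discrete_solution Om A (fe_space Om k (Th h)) eps f u' ->
              forall x, closure Om x -> u' x = u x
          & normH2 Om u <= C * normL2 Om f].
Proof.
have [C C0' adj] := hadj; exists C => // h eps hh hlt heps f f2.
have [_ meshh _] := hTh h hh.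
have [J [e span]] := @fe_space_finite_span R n Om k (Th h) meshh.
have VL := fe_space_lincomb_closed hOm k (Th h).
apply: (discrete_solution_stable hOm hAcont VL _ span _ C0' _ f2).
- by move=> v /(hconf h hh)[].
- exact: fe_space_normL2_eq0.
- by move=> v; exact: adj.
Qed.
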